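(* $|F(n,4,9)|=2^{\gamma n^2+o(n^2)}$, where $\beta=\frac{\log 3}{2\log 3-\log 2}$ and $\gamma=\beta^2/2+\beta(1-\beta)\log_2 3$.
   Context: A multigraph is a pair $(V,w)$ with $w:\binom{V}{2}\to\mathbb{N}=\{0,1,2,\dots\}$. $F(n,4,9)$ is the set of multigraphs on vertex set $[n]=\{1,\dots,n\}$ such that every 4 vertices span total multiplicity at most 9, i.e. $\sum_{xy\in\binom{X}{2}}w(xy)\le 9$ for all $X\in\binom{[n]}{4}$. Logarithms are natural. *)

(* Defs.v *)
From mathcomp Require Import all_boot all_order all_algebra finmap.
From mathcomp Require Import all_classical all_reals all_analysis.

Set Implicit Arguments.
Unset Strict Implicit.
Unset Printing Implicit Defensive.

Import Order.TTheory GRing.Theory Num.Theory.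
Import numFieldNormedType.Exports.

Local Open Scope classical_set_scope.
Local Open Scope ring_scope.

Definition pairs (V : finType) : Type := {e : {set V} | #|e| == 2%N}.

(* Finite functions rather than bare functions, so that multigraphs form a
   choiceType and finite classical sets of them have a cardinality. *)
Definition multigraph (V : finType) : Type := {ffun pairs V -> nat}.

Definition multiplicity (V : finType) (w : multigraph V) (X : {set V}) : nat :=
  (\sum_(e : pairs V | val e \subset X) w e)%N.

(* The vertex set {1, ..., n} is rendered as 'I_n = {0, ..., n-1}. *)
Definition F (n s q : nat) : set (multigraph 'I_n) :=
  [set w | forall X : {set 'I_n}, #|X| = s -> (multiplicity w X <= q)%N].

Arguments F : clear implicits.

(* [fset_set] sends an infinite set to the empty one, so [cardF n s q] is the
   cardinality of [F n s q] when the latter is finite, and 0 otherwise. The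
   infinite case does occur, e.g. for 2 <= n < s, where the constraint is void. *)
Definition cardF (n s q : nat) : nat := #|` fset_set (F n s q)|%fset.

Definition log2 {R : realType} (x : R) : R := ln x / ln 2.

Definition beta {R : realType} : R := ln 3 / (2 * ln 3 - ln 2).

Definition gamma {R : realType} : R :=
  beta ^+ 2 / 2 + beta * (1 - beta) * log2 3.

(* Main.v *)
Require Import Defs.
From mathcomp Require Import all_boot all_order all_algebra finmap.
From mathcomp Require Import reals sequences exp zify ring lra.

(** Lower bound: choose a set [A] of about [beta n] vertices and allow multiplicity
    at most 1 inside [A], 2 between [A] and its complement, 0 elsewhere.

    Upper bound, extremal part. Write [u = w + 1], so that four vertices span at
    most 15, and bound the product of the [u a b] by removing at most three vertices
    at a time: a triangle of sum at least 9 sends at most 6 (product at most 8) to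
    every other vertex, and if there is none then an edge [u a b >= 4] sends at most 4
    (product at most 4); both are cheap. Otherwise all [u] are 1, 2 or 3 (white,
    blue, red), red has no triangle, and there is no red 4-cycle with two blue
    diagonals. If every vertex had large degree, then counting the red
    neighbours of a maximal pairwise blue subset of the red neighbourhood of a
    vertex would give more than [#|M|] vertices.

    Upper bound, counting part. Let [x] be uniform on the multigraphs to be
    counted, and reveal all pairs touching a set [S] of vertices. An energy
    increment argument gives [S] of bounded size such that revealing two more
    vertices hardly changes, on average, the conditional law of the multiplicity
    of a pair; hence the six multiplicities on most 4-sets are nearly conditionally
    independent. So the multigraph [cap] of the largest multiplicities that
    remain conditionally not too unlikely spans at most 9 on most 4-sets, and by
    averaging over small vertex sets it obeys the extremal bound
    approximately. By Gibbs' inequality the logarithm of the number of multigraphs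
    is at most the mean of the sum of [ln (cap e + 1)], up to small terms. *)

Set Implicit Arguments.
Unset Strict Implicit.
Unset Printing Implicit Defensive.

Import Order.TTheory GRing.Theory Num.Theory.

Local Open Scope ring_scope.

(** * Arithmetic of the constants, and logarithms of natural numbers *)

Section Constants.
Variable R : realType.

Lemma ln2_gt0 : 0 < ln 2 :> R.
Proof. by apply: ln_gt0; lra. Qed.

Lemma ln2_lt_ln3 : ln 2 < ln 3 :> R.
Proof. by rewrite ltr_ln ?posrE; lra. Qed.

(** The derivative of [b ^+ 2 / 2 * ln 2 + b * (1 - b) * ln 3] vanishes at [b = beta]; the
    optimality of [beta] is used in this form. *)
Lemma beta_stationary : beta * (2 * ln 3 - ln 2) = ln 3 :> R.
Proof.
rewrite /beta mulfVK //; have := ln2_gt0; have := ln2_lt_ln3 => *.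
by apply: lt0r_neq0; lra.
Qed.

Lemma beta_ge0 : 0 <= beta :> R.
Proof.
have := ln2_gt0; have := ln2_lt_ln3 => *.
by rewrite /beta divr_ge0 //; lra.
Qed.

Lemma beta_le1 : beta <= 1 :> R.
Proof.
have := ln2_gt0; have := ln2_lt_ln3 => *.
by rewrite /beta ler_pdivrMr; lra.
Qed.

(** At the stationary point all vertices of the optimal construction have the same logarithmic
    degree, about [beta * ln 3 * n]. This makes [beta * ln 3] the threshold for removing
    vertices. *)
Lemma gamma_ln2 : 2 * (gamma * ln 2) = beta * ln 3 :> R.
Proof.
have l2 := ln2_gt0; have bE := beta_stationary.
rewrite /gamma /log2.
have -> : 2 * ((beta ^+ 2 / 2 + beta * (1 - beta) * (ln 3 / ln 2)) * ln 2) =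
    2 * (beta * ln 3) - beta * (beta * (2 * ln 3 - ln 2)) :> R.
  by field; rewrite gt_eqF.
by rewrite bE; ring.
Qed.

(** Equivalent to [0 <= (ln 3 - ln 2) ^+ 2]. It makes a factor of at most 2 per removed vertex
    affordable. *)
Lemma ln2_le_beta_ln3 : ln 2 <= beta * ln 3 :> R.
Proof.
have l2 := ln2_gt0; have l3 := ln2_lt_ln3.
rewrite /beta mulrAC ler_pdivlMr; last by lra.
have : 0 <= (ln 3 - ln 2) ^+ 2 :> R by apply: sqr_ge0.
by rewrite expr2; nra.
Qed.

Lemma ln_nat_le (a b : nat) : (0 < a)%N -> (a <= b)%N -> ln a%:R <= ln b%:R :> R.
Proof. by move=> a0 ab; rewrite ler_ln ?posrE ?ltr0n ?ler_nat //; lia. Qed.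

Lemma ln_nat_ge0 (a : nat) : 0 <= ln a%:R :> R.
Proof.
case: a => [|a]; first by rewrite ln0.
by apply: ln_ge0; rewrite ler1n.
Qed.

Lemma ln_pow2 (k : nat) : ln (2 ^ k)%N%:R = k%:R * ln 2 :> R.
Proof. by rewrite natrX lnXn ?ltr0n // mulr_natl. Qed.

Lemma ln_natM (a b : nat) : (0 < a)%N -> (0 < b)%N ->
  ln (a * b)%N%:R = ln a%:R + ln b%:R :> R.
Proof. by move=> a0 b0; rewrite natrM lnM ?posrE ?ltr0n. Qed.

Lemma ln_prod (I : finType) (f : I -> R) : (forall i, 0 < f i) ->
  ln (\prod_i f i) = \sum_i ln (f i).
Proof.
move=> f0; suff [_ //] : 0 < \prod_i f i /\ ln (\prod_i f i) = \sum_i ln (f i).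
elim/big_rec2: _ => [|i a b _ [b0 <-]]; first by rewrite ln1.
by rewrite mulr_gt0 // lnM ?posrE.
Qed.

End Constants.

(** * Cardinalities of finite sets *)

Lemma set4E (T : finType) (a b c d : T) :
  [set a; b; c; d] = [set x in [:: a; b; c; d]].
Proof. by apply/setP => x; rewrite !inE !orbA. Qed.

Lemma cardsU_disjoint (T : finType) (A B : {set T}) :
  [disjoint A & B] -> #|A :|: B| = (#|A| + #|B|)%N.
Proof. by move=> AB; apply/eqP; rewrite (leq_card_setU A B). Qed.

Lemma card_bigcup_disjoint (T I : finType) (J : {set I}) (B : I -> {set T}) :
  {in J &, forall i j, i != j -> [disjoint B i & B j]} ->
  #|\bigcup_(j in J) B j| = (\sum_(j in J) #|B j|)%N.
Proof.
move=> dB; rewrite big_mkcond [RHS]big_mkcond /= -sum1_card.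
rewrite partition_disjoint_bigcup => [|i j ij].
  by apply: eq_bigr => i _; rewrite sum1_card; case: ifP => // _; rewrite cards0.
case: ifP => iJ; last by rewrite -setI_eq0 set0I.
by case: ifP => jJ; [exact: dB | rewrite -setI_eq0 setI0].
Qed.

(** * The extremal problem *)

(* [u a b] stands for the multiplicity of [ab] plus one, so a total multiplicity
   of 9 on four vertices becomes 15; the value 1 on the diagonal is a convention. *)
Section Extremal.
Variables (R : realType) (V : finType) (u : V -> V -> nat).
Hypothesis u_sym : forall a b, u a b = u b a.
Hypothesis u_diag : forall a, u a a = 1%N.
Hypothesis u_gt0 : forall a b, (0 < u a b)%N.
Hypothesis u_le10 : forall a b, (u a b <= 10)%N.

Definition sparse4 (M : {set V}) := forall a b c d,
  a \in M -> b \in M -> c \in M -> d \in M -> uniq [:: a; b; c; d] ->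
  (u a b + u a c + u a d + u b c + u b d + u c d <= 15)%N.

Let L a b : R := ln (u a b)%:R.

(** By contradiction: if all degrees exceed the bound, red neighbourhoods are large compared with
    white ones, and the disjoint sets counted in [pack] overfill [M]. *)
Lemma light_vertex (M : {set V}) : sparse4 M -> M != set0 ->
  (forall a b, a \in M -> b \in M -> (u a b <= 3)%N) ->
  (forall a b c, a \in M -> b \in M -> c \in M -> (u a b + u b c + u a c <= 8)%N) ->
  exists2 v, v \in M & \sum_(x in M) L v x <= beta * ln 3 * #|M|%:R.
Proof.
move=> M4 /set0Pn[v vM] M3 Mtri; apply/exists_inP; rewrite -[X in is_true X]negbK.
rewrite negb_exists_in; apply/negP => /forall_inP heavy.
pose Rd v := [set x in M | u v x == 3%N].
pose Wh v := [set x in M | u v x == 1%N].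
have l2 := ln2_gt0 R; have l3 := ln2_lt_ln3 R; have bE := beta_stationary R.
(* With red and white degrees [r] and [w], the logarithmic degree is [ln 2 * #|M| + (ln 3 - ln 2) *
   r - ln 2 * w]; [a] itself counts as white. *)
have vRd : forall a, a \in M ->
    (beta * ln 3 - ln 2) * #|M|%:R + ln 2 * #|Wh a|%:R < (ln 3 - ln 2) * #|Rd a|%:R :> R.
  move=> a aM; move: (heavy a aM); rewrite -ltNge.
  have -> : \sum_(x in M) L a x =
     \sum_(x in M) (ln 2 + (ln 3 - ln 2) * (u a x == 3%N)%:R - ln 2 * (u a x == 1%N)%:R).
    apply: eq_bigr => x xM; rewrite /L.
    have := M3 a x aM xM; have := u_gt0 a x.
    by case: (u a x) => [|[|[|[|k]]]] //= _ _; rewrite ?ln1; lra.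
  rewrite big_split big_split /= sumrN -!mulr_sumr -!natr_sum.
  have -> : (\sum_(i in M) (u a i == 3))%N = #|Rd a|.
    by rewrite -sum1dep_card big_mkcondr /=; apply: eq_bigr => i _; case: eqP.
  have -> : (\sum_(i in M) (u a i == 1))%N = #|Wh a|.
    by rewrite -sum1dep_card big_mkcondr /=; apply: eq_bigr => i _; case: eqP.
  by rewrite sumr_const -[ln 2 *+ _]mulr_natr; lra.
(* [J] is maximal among the pairwise blue subsets of the red neighbourhood of [v];
   by maximality the white classes of its elements cover that neighbourhood. *)
pose P (J : {set V}) := (J \subset Rd v) &&
  [forall a in J, forall b in J, (a != b) ==> (u a b != 1%N)].
have [J /maxsetP[/andP[JR /forall_inP JP] Jmax]] : {J | maxset P J}.
  apply: ex_maxset; exists set0; rewrite /P sub0set /=.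
  by apply/forall_inP => a; rewrite inE.
have JB a b : a \in J -> b \in J -> a != b -> u a b != 1%N.
  by move=> aJ bJ ab; move/forall_inP: (JP a aJ) => /(_ b bJ) /implyP; apply.
have JM a : a \in J -> a \in M /\ u v a = 3%N.
  by move=> /(subsetP JR); rewrite inE => /andP[-> /eqP ->].
have cover : Rd v \subset \bigcup_(j in J) Wh j.
  apply/subsetP => z zR; move: (zR); rewrite inE => /andP[zM zv].
  apply/bigcupP; have [/exists_inP[j jJ wj]|] := boolP [exists j in J, u j z == 1%N].
    by exists j => //; rewrite inE zM.
  rewrite negb_exists_in => /forall_inP nw.
  suff zJ : z \in J by exists z => //; rewrite inE zM u_diag.
  have -> : J = z |: J; last by rewrite setU11.
  apply/esym/Jmax; last by rewrite subsetUr.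
  rewrite /P; apply/andP; split; first by rewrite subUset sub1set zR JR.
  apply/forall_inP => a /setU1P aJ; apply/forall_inP => b /setU1P bJ; apply/implyP => ab.
  case: aJ bJ ab => [->|aJ] [->|bJ]; rewrite ?eqxx // => ab; last exact: JB.
    by rewrite u_sym; apply: nw.
  exact: nw.
have rJ : (#|Rd v| <= \sum_(j in J) #|Wh j|)%N.
  apply: leq_trans (subset_leq_card cover) _.
  elim/big_rec2: _ => [|j m A jJ le]; first by rewrite cards0.
  by rewrite cardsU; apply: leq_trans (leq_subr _ _) _; rewrite leq_add2l.
have dRW a : [disjoint Rd a & Wh a].
  by rewrite -setI_eq0; apply/eqP/setP => z; rewrite !inE; case: eqP => [->|]; rewrite ?andbF.
(* A common red neighbour [z] of distinct [i], [j] in [J] closes a red cycle [v i z j]; as [ij] is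
   not white, the bound 15 makes [vz] white. Since there is no red triangle, the sets also avoid
   [Rd v]. *)
have pack : (\sum_(j in J) #|Rd j :\: Wh v| + (#|Rd v| + #|Wh v|) <= #|M|)%N.
  have cardU : #|\bigcup_(j in J) (Rd j :\: Wh v)| = (\sum_(j in J) #|Rd j :\: Wh v|)%N.
    apply: card_bigcup_disjoint => i j iJ jJ ij.
    rewrite -setI_eq0; apply/eqP/setP => z; rewrite !inE.
    apply/negP => /andP[/andP[w1 /andP[zM /eqP iz]] /andP[_ /andP[_ /eqP jz]]].
    rewrite zM /= in w1; have [iM vi] := JM i iJ; have [jM vj] := JM j jJ.
    have bij := JB i j iJ jJ ij.
    have U : uniq [:: v; i; j; z].
      have neq a b : u a b != 1%N -> a != b.
        by apply: contraNneq => ->; rewrite u_diag.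
      by rewrite /= !inE !negb_or !neq // ?vi ?vj ?iz ?jz.
    have := M4 v i j z vM iM jM zM U; rewrite vi vj iz jz.
    by have := u_gt0 v z; have := u_gt0 i j; move: bij w1; clear; lia.
  rewrite -cardU -(cardsU_disjoint (dRW v)).
  rewrite -cardsU_disjoint; last first.
    rewrite -setI_eq0; apply/eqP/setP => z; rewrite 2!inE [in RHS]inE.
    apply/negP => /andP[/bigcupP[j jJ]]; rewrite 2!inE => /andP[w1 zj] /orP[zv|]; last exact/negP.
    move: zj zv; rewrite !inE => /andP[zM /eqP jz] /andP[_ /eqP vz].
    by have [jM vj] := JM j jJ; have := Mtri v j z vM jM zM; rewrite vj jz vz.
  apply: subset_leq_card; rewrite !subUset; apply/and3P; split.
  - apply/bigcupsP => j _; apply: subset_trans (subsetDl _ _) _.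
    by apply/subsetP => z; rewrite inE => /andP[].
  - by apply/subsetP => z; rewrite inE => /andP[].
  - by apply/subsetP => z; rewrite inE => /andP[].
set m : R := #|M|%:R in heavy vRd.
set r : R := #|Rd v|%:R; set wv : R := #|Wh v|%:R.
have hv := vRd v vM; rewrite -/r -/wv in hv.
have m0 : 0 < m by rewrite ltr0n card_gt0; apply/set0Pn; exists v.
have wv0 : 0 <= wv by rewrite ler0n.
have r0 : 0 < r.
  have := ln2_le_beta_ln3 R; nra.
have kJ : (0 < #|J|)%N.
  rewrite lt0n; apply: contraTneq r0 => /cards0_eq J0; rewrite -leNgt lern0 -leqn0.
  by apply: leq_trans rJ _; rewrite J0 big_set0.
set k : R := #|J|%:R; have k1 : 1 <= k by rewrite ler1n.
have rwm : r + wv <= m.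
  by rewrite -natrD ler_nat; apply: leq_trans pack; rewrite leq_addl.
have sumR : (ln 3 - ln 2) * \sum_(j in J) #|Rd j|%:R >=
    k * ((beta * ln 3 - ln 2) * m) + ln 2 * r.
  have rJ' : r <= \sum_(j in J) #|Wh j|%:R by rewrite -natr_sum ler_nat.
  apply: (@le_trans _ _ (\sum_(j in J) ((beta * ln 3 - ln 2) * m + ln 2 * #|Wh j|%:R))).
    rewrite big_split /= sumr_const -mulr_sumr -[_ *+ #|J|]mulr_natl lerD2l.
    by rewrite ler_pM2l.
  rewrite mulr_sumr; apply: ler_sum => j jJ; apply/ltW/vRd.
  by case: (JM j jJ).
have packR : \sum_(j in J) #|Rd j|%:R - k * wv + (r + wv) <= m.
  have := pack; rewrite -(ler_nat R) !natrD natr_sum; apply: le_trans.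
  rewrite lerD2r /k -[#|J|]sum1_card natr_sum mulr_suml -sumrB.
  apply: ler_sum => j jJ; rewrite mul1r lerBlDr -natrD ler_nat -(cardsID (Wh v) (Rd j)) addnC leq_add2l.
  by apply: subset_leq_card; apply: subsetIr.
set S : R := \sum_(j in J) _ in sumR packR.
have D0 : 0 < 2 * ln 3 - ln 2 :> R by lra.
have bl3 : (beta * ln 3 - ln 2) * (2 * ln 3 - ln 2) = (ln 3 - ln 2) ^+ 2 :> R.
  by rewrite mulrBl mulrAC bE; ring.
set x : R := beta * ln 3 - ln 2 in hv sumR bl3.
set y : R := ln 3 - ln 2 in hv sumR bl3.
set z : R := ln 2 in l2 hv sumR.
have y0 : 0 < y by rewrite /y; lra.
have l3E : ln 3 = y + z :> R by rewrite /y /z; lra.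
have DE : 2 * ln 3 - ln 2 = 2 * y + z :> R by rewrite l3E /z; lra.
rewrite DE in bl3 D0.
have xE : x = y ^+ 2 / (2 * y + z) by rewrite -bl3 mulfK // gt_eqF.
(* [t] equals [1 - beta]. The white degree of [v] is at most [t * m] and its red degree is larger
   than [t * m]; hence [k] may be replaced by 1 in the count, which is then already
   contradictory. *)
pose t := y / (2 * y + z).
have tE : (2 * y + z) * t = y by rewrite /t mulrC divfK // gt_eqF.
have {}xE : x = y * t by rewrite xE /t expr2 mulrA.
rewrite {}xE in hv sumR.
have e1 : y * m = 2 * (y * t * m) + z * t * m by rewrite -[in LHS]tE; ring.
have wlt : wv <= t * m.
  have yz : 0 < y + z by lra.
  rewrite -(ler_pM2l yz).
  have : y * (r + wv) <= y * m by rewrite ler_pM2l.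
  by lra.
have rlt : t * m < r.
  have : 0 <= z * wv by rewrite mulr_ge0 // ltW.
  by rewrite -(ltr_pM2l y0); lra.
have : k * (y * (t * m - wv)) >= y * (t * m - wv).
  by rewrite ler_peMl // mulr_ge0 ?subr_ge0 // ltW.
have : y * (S - k * wv + (r + wv)) <= y * m by rewrite ler_pM2l.
have : z * (t * m) < z * r by rewrite ltr_pM2l.
have : 0 <= z * wv by rewrite mulr_ge0 // ltW.
by lra.
Qed.

(** [K] is a triangle of sum at least 9, else an edge with [u >= 4], else a light vertex. In the
    first two cases the product from an outside vertex to [K] is at most [2 ^ #|K|], and
    [ln 2 <= beta * ln 3]. *)
Lemma light_set (M : {set V}) : sparse4 M -> M != set0 ->
  exists2 K : {set V}, (K \subset M) && (0 < #|K| <= 3)%N &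
    \sum_(v in M :\: K) \sum_(a in K) L a v <= beta * ln 3 * #|K|%:R * #|M|%:R.
Proof.
move=> M4 M0.
have l2 := ln2_gt0 R; have l2b := ln2_le_beta_ln3 R.
have bound (K : {set V}) : K \subset M -> (0 < #|K| <= 3)%N ->
    (forall v, v \in M :\: K -> \sum_(a in K) L a v <= beta * ln 3 * #|K|%:R) ->
  exists2 K : {set V}, (K \subset M) && (0 < #|K| <= 3)%N &
    \sum_(v in M :\: K) \sum_(a in K) L a v <= beta * ln 3 * #|K|%:R * #|M|%:R.
  move=> KM K3 H; exists K; first by rewrite KM.
  apply: le_trans (ler_sum _ H) _; rewrite sumr_const -[_ *+ #|_ :\: _|]mulr_natr.
  apply: ler_wpM2l; first by rewrite mulr_ge0 //; lra.
  by rewrite ler_nat subset_leq_card // subsetDl.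
have [T9|noT9] := boolP [exists a in M, exists b in M, exists c in M,
    uniq [:: a; b; c] && (9 <= u a b + u b c + u a c)%N].
  case/exists_inP: T9 => a aM /exists_inP[b bM /exists_inP[c cM /andP[abc T9]]].
  have ab : a != b by move: abc; rewrite /= !inE negb_or; case: (a != b).
  have ac : a != c by move: abc; rewrite /= !inE negb_or; case: (a != c); rewrite ?andbF.
  have bc : b != c by move: abc; rewrite /= !inE; case: (b != c); rewrite ?andbF.
  have aK : a \notin [set b; c] by rewrite !inE negb_or ab.
  have K3 : #|a |: [set b; c]| = 3%N by rewrite cardsU1 aK cards2 bc.
  apply: (bound (a |: [set b; c])); rewrite ?K3 ?subUset ?sub1set ?aM ?bM ?cM //.
  move=> v; rewrite !inE !negb_or => /andP[/and3P[va vb vc] vM].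
  rewrite big_setU1 //= big_setU1 ?inE //= big_set1.
  have U : uniq [:: v; a; b; c] by rewrite cons_uniq abc !inE !negb_or va vb vc.
  have := M4 v a b c vM aM bM cM U; rewrite !(u_sym v) => S15.
  rewrite /L -!ln_natM ?muln_gt0 ?u_gt0 //.
  apply: (@le_trans _ _ (ln (2 ^ 3)%N%:R)); last by rewrite ln_pow2; lra.
  apply: ln_nat_le; first by rewrite !muln_gt0 !u_gt0.
  have : (u a v + u b v + u c v <= 6)%N by move: S15 T9; clear; lia.
  have := u_gt0 a v; have := u_gt0 b v; have := u_gt0 c v.
  case: (u a v) => [|[|[|[|[|x]]]]] //; case: (u b v) => [|[|[|[|[|y]]]]] //;
    case: (u c v) => [|[|[|[|[|z]]]]] //; clear; lia.
have tri a b c : a \in M -> b \in M -> c \in M -> uniq [:: a; b; c] ->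
    (u a b + u b c + u a c <= 8)%N.
  move=> aM bM cM abc; rewrite leqNgt; apply: contra noT9 => T9.
  apply/exists_inP; exists a => //; apply/exists_inP; exists b => //.
  by apply/exists_inP; exists c => //; rewrite abc.
have [E4|noE4] := boolP [exists a in M, exists b in M, (4 <= u a b)%N].
  case/exists_inP: E4 => a aM /exists_inP[b bM E4].
  have ab : a != b by apply: contraTneq E4 => ->; rewrite u_diag.
  apply: (bound [set a; b]); rewrite ?cards2 ?ab ?subUset ?sub1set ?aM ?bM //.
  move=> v; rewrite !inE !negb_or => /andP[/andP[va vb] vM].
  rewrite big_setU1 ?inE //= big_set1.
  have U : uniq [:: a; b; v] by rewrite /= !inE negb_or ab !(eq_sym _ v) va vb.
  have T8 := tri a b v aM bM vM U.
  rewrite /L -!ln_natM ?u_gt0 //.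
  apply: (@le_trans _ _ (ln (2 ^ 2)%N%:R)); last by rewrite ln_pow2; lra.
  apply: ln_nat_le; first by rewrite !muln_gt0 !u_gt0.
  have : (u a v + u b v <= 4)%N by move: T8 E4; clear; lia.
  have := u_gt0 a v; have := u_gt0 b v.
  case: (u a v) => [|[|[|[|[|x]]]]] //; case: (u b v) => [|[|[|[|[|y]]]]] //; clear; lia.
have M3 a b : a \in M -> b \in M -> (u a b <= 3)%N.
  move=> aM bM; rewrite leqNgt; apply: contra noE4 => E4.
  by apply/exists_inP; exists a => //; apply/exists_inP; exists b.
case: (light_vertex M4 M0 M3) => [a b c aM bM cM|v vM hv].
  have := M3 a b aM bM; have := M3 b c bM cM; have := M3 a c aM cM.
  have [<-|ab] := eqVneq a b; first by rewrite u_diag; clear; lia.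
  have [<-|ac] := eqVneq a c; first by rewrite u_diag; clear; lia.
  have [<-|bc] := eqVneq b c; first by rewrite u_diag; clear; lia.
  by move=> _ _ _; apply: tri => //; rewrite /= !inE negb_or ab ac bc.
exists [set v]; first by rewrite sub1set vM cards1.
rewrite cards1 mulr1; apply: le_trans hv.
apply: (@le_trans _ _ (\sum_(x in M :\: [set v]) L v x)).
  by apply: ler_sum => x _; rewrite big_set1.
rewrite [leRHS](big_setID [set v]) /= lerDr.
by apply: sumr_ge0 => x _; apply: ln_nat_ge0.
Qed.

(** Induction on [#|M|], removing [K] from [light_set]. The linear term pays for the at most 9
    ordered pairs inside [K], each worth at most [ln 10], and for the net excess
    [beta * ln 3 * #|K| ^+ 2] due to the factor [#|M|] in place of [#|M :\: K|]. *)
Lemma sparse4_sum_le (M : {set V}) : sparse4 M ->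
  \sum_(a in M) \sum_(b in M) L a b <=
    beta * ln 3 * #|M|%:R ^+ 2 + (9 * (beta * ln 3) + 9 * ln 10) * #|M|%:R.
Proof.
set C : R := _ + 9 * ln 10.
elim: {M}_.+1 {-2}M (ltnSn #|M|) => // n IH M Mn M4.
have [->|M0] := eqVneq M set0.
  by rewrite big_set0 cards0; lra.
have [K /andP[KM /andP[K0 K3]] light] := light_set M4 M0.
have Lsym a b : L a b = L b a by rewrite /L u_sym.
have MK : M = K :|: (M :\: K) by rewrite -{1}(setID M K) (setIidPr KM).
have dMK : [disjoint K & M :\: K] by apply/pred0P => x /=; rewrite !inE; case: (x \in K).
have cM : #|M| = (#|K| + #|M :\: K|)%N by rewrite {1}MK cardsU_disjoint.
have {}IH : \sum_(a in M :\: K) \sum_(b in M :\: K) L a b <=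
    beta * ln 3 * #|M :\: K|%:R ^+ 2 + C * #|M :\: K|%:R.
  apply: IH; first by move: Mn K0; rewrite cM; lia.
  move=> a b c d; rewrite !inE => /andP[_ ?] /andP[_ ?] /andP[_ ?] /andP[_ ?].
  exact: M4.
have -> : \sum_(a in M) \sum_(b in M) L a b =
  \sum_(a in K) \sum_(b in K) L a b + 2 * \sum_(v in M :\: K) \sum_(a in K) L a v +
    \sum_(a in M :\: K) \sum_(b in M :\: K) L a b.
  have split_M (f : V -> R) : \sum_(a in M) f a = \sum_(a in K) f a + \sum_(a in M :\: K) f a.
    by rewrite (big_setID K) /= (setIidPr KM).
  rewrite split_M; under eq_bigr do rewrite split_M.
  under [X in _ + X = _]eq_bigr do rewrite split_M.
  rewrite !big_split /= [X in _ + X + _ = _]exchange_big /=.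
  under [X in _ + (X + _) = _]eq_bigr do under eq_bigr do rewrite Lsym.
  by ring.
have TK : \sum_(a in K) \sum_(b in K) L a b <= 9 * ln 10.
  apply: (@le_trans _ _ (\sum_(a in K) \sum_(b in K) ln 10)).
    by do 2![apply: ler_sum => ? _]; apply: ln_nat_le.
  have l10 : 0 <= ln 10 :> R by apply: ln_nat_ge0.
  rewrite !sumr_const -mulrnA -[_ *+ _]mulr_natl ler_wpM2r // ler_nat.
  by move: K3; case: #|K| => [|[|[|[|]]]].
have bl3 : 0 <= beta * ln 3 :> R by have := ln2_le_beta_ln3 R; have := ln2_gt0 R; lra.
have k1 : 1 <= #|K|%:R :> R by rewrite ler1n.
have k3 : #|K|%:R <= 3 :> R by rewrite ler_nat.
have mE : #|M|%:R = #|K|%:R + #|M :\: K|%:R :> R by rewrite cM natrD.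
rewrite {}mE in light *.
have C0 : 9 * (beta * ln 3) + 9 * ln 10 <= C * #|K|%:R.
  by rewrite -/C ler_peMr // /C addr_ge0 // mulr_ge0 // ln_nat_ge0.
have kk : beta * ln 3 * #|K|%:R ^+ 2 <= 9 * (beta * ln 3) :> R.
  rewrite mulrC ler_wpM2r // expr2.
  have -> : 9 = 3 * 3 :> R by ring.
  by apply: ler_pM => //; apply: le_trans k1.
move: light TK IH kk C0; rewrite !expr2; move: (beta * ln 3) => bl.
move: #|K|%:R #|M :\: K|%:R => k m; move: (\sum_(_ in _) _) => S1.
move: (\sum_(_ in _) _) => S2; move: (\sum_(_ in _) _) => S3; move: (ln 10) => l10.
move: C => C; lra.
Qed.

End Extremal.

(** * Supersaturation *)

Section Pairs.
Variable V : finType.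

(** A function on two-element sets, seen as a symmetric function of two vertices: [insub] fails
    exactly when [a = b], which gives [x0] on the diagonal. *)
Definition pair_apply (T : Type) (x0 : T) (f : pairs V -> T) (a b : V) : T :=
  oapp f x0 (insub [set a; b]).

Lemma pair_apply_sym (T : Type) (x0 : T) f a b :
  pair_apply x0 f a b = pair_apply x0 f b a.
Proof. by rewrite /pair_apply setUC. Qed.

Lemma pair_apply_diag (T : Type) (x0 : T) f a : pair_apply x0 f a a = x0.
Proof. by rewrite /pair_apply insubN // setUid cards1. Qed.

Lemma pair_apply_neq (T : Type) (x0 : T) f a b : a != b ->
  exists2 e : pairs V, val e = [set a; b] & pair_apply x0 f a b = f e.
Proof.
move=> ab; have c2 : #|[set a; b]| == 2%N by rewrite cards2 ab.
by exists (Sub [set a; b] c2); rewrite ?SubK // /pair_apply (insubT (fun e : {set V} => #|e| == 2%N) c2).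
Qed.

(** A pair [{a, b}] arises from exactly [(a, b)] and [(b, a)], and the diagonal contributes 0. *)
Lemma pair_sum (U : nmodType) (f : pairs V -> U) (M : {set V}) :
  (\sum_(e : pairs V | val e \subset M) f e) *+ 2 =
  \sum_(a in M) \sum_(b in M) pair_apply 0 f a b.
Proof.
rewrite pair_big /=.
transitivity (\sum_(p : V * V | (p.1 \in M) && (p.2 \in M))
   \sum_(e : pairs V | val e == [set p.1; p.2]) f e); last first.
  apply: eq_bigr => -[a b] /= _; rewrite /pair_apply.
  case: insubP => [e He ve|ab] /=.
    by rewrite (big_pred1 e) // => e'; rewrite -ve.
  by rewrite big_pred0 // => e; apply: contraNF ab => /eqP <-; case: e.
rewrite (exchange_big_dep (fun e : pairs V => val e \subset M)) /=; last first.
  by move=> p e /andP[p1 p2] /eqP ->; rewrite subUset !sub1set p1.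
rewrite -sumrMnl; apply: eq_bigr => e eM; rewrite sumr_const; congr (_ *+ _).
have /cards2P[a [b [ab eE]]] := valP e.
transitivity #|[set (a, b); (b, a)]|; first by rewrite cards2 xpair_eqE (negPf ab).
apply: eq_card => -[x y]; rewrite !inE /= -topredE /= !xpair_eqE.
move: eM; rewrite eE subUset !sub1set => /andP[aM bM].
apply/idP/idP => [/orP[]/andP[/eqP-> /eqP->]|/andP[/andP[xM yM] /eqP E]].
- by rewrite aM bM eqxx.
- by rewrite aM bM setUC eqxx.
have : x \in [set a; b] by rewrite E !inE eqxx.
have : y \in [set a; b] by rewrite E !inE eqxx orbT.
have : a \in [set x; y] by rewrite -E !inE eqxx.
have : b \in [set x; y] by rewrite -E !inE eqxx orbT.
rewrite !inE => + + + /orP[] /eqP xE; rewrite xE eqxx /=.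
  by rewrite [b == a]eq_sym (negPf ab) /= => /eqP <- _ _; rewrite eqxx.
by rewrite (negPf ab) /= => _ /eqP <- _; rewrite eqxx orbT.
Qed.

Lemma pair_sum4 (w : pairs V -> nat) a b c d : uniq [:: a; b; c; d] ->
  let W := pair_apply 0%N w in
  (\sum_(e : pairs V | val e \subset [set a; b; c; d]) w e =
    W a b + W a c + W a d + W b c + W b d + W c d)%N.
Proof.
move=> U W; set X := [set a; b; c; d].
have E : (\sum_(e : pairs V | val e \subset X) w e + \sum_(e : pairs V | val e \subset X) w e =
    \sum_(x in X) \sum_(y in X) W x y)%N by exact: (pair_sum w X).
have big4 (f : V -> nat) : (\sum_(x in X) f x = f a + f b + f c + f d)%N.
  rewrite -[in RHS]addnA -[in RHS]addnA.
  rewrite /X set4E (eq_bigl (fun x => x \in [:: a; b; c; d])); last by move=> x; rewrite inE.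
  by rewrite -big_uniq //= !big_cons big_nil addn0.
move: E; rewrite !big4 /W !pair_apply_diag.
rewrite (pair_apply_sym _ _ b a) (pair_apply_sym _ _ c a) (pair_apply_sym _ _ d a).
rewrite (pair_apply_sym _ _ c b) (pair_apply_sym _ _ d b) (pair_apply_sym _ _ d c).
by clear; move: (\sum_(_ | _) _)%N => S; lia.
Qed.

End Pairs.

Lemma card_supersets (V : finType) (A : {set V}) (m : nat) : (#|A| <= m)%N ->
  #|[set M : {set V} | (A \subset M) && (#|M| == m)]| = 'C(#|V| - #|A|, m - #|A|).
Proof.
move=> Am; have -> : (#|V| - #|A| = #|~: A|)%N by rewrite [RHS]cardsCs setCK.
rewrite -cards_draws.
have dA (B : {set V}) : B \subset ~: A -> [disjoint A & B].
  by rewrite subsets_disjoint setCK disjoint_sym.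
rewrite -[RHS](@card_in_imset _ _ (fun B => A :|: B)) => [|B B']; last first.
  rewrite !inE => /andP[BA _] /andP[BA' _] E.
  have : (A :|: B) :\: A = (A :|: B') :\: A by rewrite E.
  by rewrite !setDUl setDv !set0U !setDE (setIidPl BA) (setIidPl BA').
apply: eq_card => M; rewrite inE; apply/andP/imsetP => [[AM /eqP Mm]|[B]].
  exists (M :\: A); last by rewrite -{1}(setID M A) (setIidPr AM).
  by rewrite inE setDE subsetIr /= -setDE cardsD (setIidPr AM) Mm.
rewrite inE => /andP[BA /eqP Bm] ->; rewrite subsetUl; split=> //.
by rewrite cardsU_disjoint ?dA // Bm subnKC.
Qed.

Section Supersaturation.
Variables (R : realType) (V : finType) (w : pairs V -> nat).
Hypothesis w_le9 : forall e, (w e <= 9)%N.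

Let lw (e : pairs V) : R := ln (w e).+1%:R.

Definition bad4 : {set {set V}} :=
  [set X : {set V} | (#|X| == 4%N) && (9 < \sum_(e : pairs V | val e \subset X) w e)%N].

Lemma ln_pair_sum (M : {set V}) :
  (\sum_(e : pairs V | val e \subset M) lw e) *+ 2 =
  \sum_(a in M) \sum_(b in M) ln (pair_apply 0%N w a b).+1%:R.
Proof.
rewrite pair_sum; do 2![apply: eq_bigr => ? _]; rewrite /pair_apply.
by case: insub => //=; rewrite ln1.
Qed.

Lemma pair_apply_le9 a b : (pair_apply 0%N w a b <= 9)%N.
Proof. by rewrite /pair_apply; case: insub => //=. Qed.

Lemma ln_pair_sum_le (M : {set V}) :
  \sum_(e : pairs V | val e \subset M) lw e <= #|M|%:R ^+ 2 * ln 10.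
Proof.
have : (\sum_(e : pairs V | val e \subset M) lw e) *+ 2 <= #|M|%:R ^+ 2 * ln 10.
  rewrite ln_pair_sum expr2 -mulrA !mulr_natl -sumr_const -sumr_const.
  do 2![apply: ler_sum => ? _].
  by apply: ln_nat_le => //; rewrite ltnS pair_apply_le9.
apply: le_trans; rewrite mulr2n lerDl; apply: sumr_ge0 => e _; exact: ln_nat_ge0.
Qed.

(** Half the linear coefficient of [sparse4_sum_le], where every pair is counted twice. *)
Definition extremal_cst : R := (9 * (beta * ln 3) + 9 * ln 10) / 2.

(** Passing to [u = w + 1] turns the bound 9 on six pairs into 15, and the diagonal value 0 into
    1. *)
Lemma ln_pair_sum_good (M : {set V}) : (forall X, X \in bad4 -> ~~ (X \subset M)) ->
  \sum_(e : pairs V | val e \subset M) lw e <=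
    gamma * ln 2 * #|M|%:R ^+ 2 + extremal_cst * #|M|%:R.
Proof.
move=> good; rewrite -(ler_pM2l (_ : 0 < 2)) ?ltr0n // mulr_natl ln_pair_sum.
have := @sparse4_sum_le R V (fun a b => (pair_apply 0%N w a b).+1) _ _ _ _ M _.
have -> : 2 * (gamma * ln 2 * #|M|%:R ^+ 2 + extremal_cst * #|M|%:R) =
   beta * ln 3 * #|M|%:R ^+ 2 + (9 * (beta * ln 3) + 9 * ln 10) * #|M|%:R :> R.
  by rewrite -gamma_ln2 /extremal_cst -gamma_ln2; field.
apply=> //.
- by move=> a b; rewrite pair_apply_sym.
- by move=> a; rewrite pair_apply_diag.
- by move=> a b; rewrite ltnS pair_apply_le9.
move=> a b c d aM bM cM dM U.
have c4 : #|[set a; b; c; d]| = 4%N.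
  by rewrite set4E cardsE; apply/card_uniqP.
have sM : [set a; b; c; d] \subset M by rewrite !subUset !sub1set aM bM cM.
have : [set a; b; c; d] \notin bad4 by apply: contraL sM => /good.
rewrite inE c4 eqxx /= -leqNgt pair_sum4 //; clear; lia.
Qed.

(** Sum over all [m]-sets [M]: those without a bad 4-set obey the extremal bound, and the others get
    the trivial bound [m ^ 2 * ln 10], charged to the bad sets they contain. *)
Lemma supersaturation_binomial (m : nat) : (4 <= m)%N ->
  'C(#|V| - 2, m - 2)%:R * \sum_(e : pairs V) lw e <=
  'C(#|V|, m)%:R * (gamma * ln 2 * m%:R ^+ 2 + extremal_cst * m%:R) +
  'C(#|V| - 4, m - 4)%:R * #|bad4|%:R * (m%:R ^+ 2 * ln 10).
Proof.
move=> m4.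
have E0 : 0 <= gamma * ln 2 * m%:R ^+ 2 + extremal_cst * m%:R :> R.
  have := gamma_ln2 R; have := ln2_le_beta_ln3 R; have := ln2_gt0 R => l2 b2 g2.
  have l10 := ln_nat_ge0 R 10.
  have : 0 <= gamma * ln 2 :> R by lra.
  have : 0 <= extremal_cst by rewrite /extremal_cst; lra.
  by move=> c0 g0; rewrite addr_ge0 // mulr_ge0 // sqr_ge0.
have -> : 'C(#|V| - 2, m - 2)%:R * \sum_(e : pairs V) lw e =
    \sum_(M : {set V} | #|M| == m) \sum_(e : pairs V | val e \subset M) lw e.
  rewrite (exchange_big_dep xpredT) //= mulr_sumr; apply: eq_bigr => e _.
  have e2 := eqP (valP e).
  rewrite sumr_const mulr_natl; congr (_ *+ _).
  rewrite -{1}e2 -[in X in (m - X)%N]e2 -card_supersets ?e2 ?(leq_trans _ m4) //.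
  by apply: eq_card => M; rewrite !inE -topredE /= andbC.
apply: (@le_trans _ _ (\sum_(M : {set V} | #|M| == m)
   ((gamma * ln 2 * m%:R ^+ 2 + extremal_cst * m%:R) +
    \sum_(X in bad4 | X \subset M) (m%:R ^+ 2 * ln 10)))).
  apply: ler_sum => M /eqP Mm.
  have T0 : 0 <= m%:R ^+ 2 * ln 10 :> R by rewrite mulr_ge0 ?sqr_ge0 ?ln_nat_ge0.
  have [/existsP[X /andP[XB XM]]|none] := boolP [exists X, (X \in bad4) && (X \subset M)].
    apply: le_trans (ln_pair_sum_le M) _; rewrite Mm (bigD1 X) ?XB //= addrA addrAC.
    by rewrite lerDr addr_ge0 // sumr_ge0.
  rewrite [X in _ <= _ + X]big_pred0 => [|X]; last first.
    by apply: contraNF none => H; apply/existsP; exists X.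
  rewrite addr0 -Mm; apply: ln_pair_sum_good => X XB.
  by apply: contra none => XM; apply/existsP; exists X; rewrite XB.
rewrite big_split /= sumr_const -[_ *+ _]mulr_natl; apply: lerD.
  rewrite ler_wpM2r //.
  rewrite ler_nat -[X in 'C(X, _)]subn0 -[X in 'C(_, X)]subn0.
  rewrite -{1}(@cards0 V) -[X in (m - X)%N](@cards0 V) -card_supersets ?cards0 //.
  by apply: subset_leq_card; apply/subsetP => M; rewrite !inE -topredE /= sub0set.
rewrite (exchange_big_dep (mem bad4)) /=; last by move=> M X _ /andP[].
rewrite [leRHS]mulrAC [leRHS]mulr_natr -[leRHS]sumr_const; apply: ler_sum => X XB.
have /andP[/eqP X4 _] : (#|X| == 4%N) && (9 < \sum_(e : pairs V | val e \subset X) w e)%N.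
  by move: XB; rewrite inE.
rewrite sumr_const -[leLHS]mulr_natl ler_wpM2r ?mulr_ge0 ?sqr_ge0 ?ln_nat_ge0 // ler_nat.
rewrite -{1}X4 -[in X in (m - X)%N]X4 -card_supersets ?X4 //.
by apply: subset_leq_card; apply/subsetP => M; rewrite !inE -topredE /= => /andP[-> /andP[_ ->]].
Qed.

(** Divide the binomial form by ['C(n - 2, m - 2)]. The two remaining ratios are
    [n (n - 1) / (m (m - 1))] and [(m - 2) (m - 3) / ((n - 2) (n - 3))]. *)
Lemma supersaturation (m : nat) : (4 <= m <= #|V|)%N -> (6 <= #|V|)%N ->
  \sum_(e : pairs V) lw e <=
    #|V|%:R ^+ 2 * (gamma * ln 2 + (gamma * ln 2 + extremal_cst) / (m%:R - 1)) +
    3 * m%:R ^+ 4 * ln 10 * (#|bad4|%:R / #|V|%:R ^+ 2).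
Proof.
case/andP=> m4 mn n6; have := supersaturation_binomial m4.
set S : R := \sum_(e : pairs V) _; set b : R := #|bad4|%:R.
set G : R := gamma * ln 2; set c : R := 'C(_ - 2, _)%:R; set A : R := 'C(_, _)%:R.
set B : R := 'C(_ - 4, _)%:R; set l10 : R := ln 10.
have G0 : 0 <= G.
  by have := gamma_ln2 R; have := ln2_le_beta_ln3 R; have := ln2_gt0 R; rewrite /G; lra.
have l0 : 0 <= l10 by exact: ln_nat_ge0.
have C0 : 0 <= extremal_cst.
  by rewrite /extremal_cst -gamma_ln2 -/G -/l10; lra.
have b0 : 0 <= b by rewrite ler0n.
have c0 : 0 < c by rewrite ltr0n bin_gt0 leq_sub2r.
have AE : A * (m%:R * (m%:R - 1)) = c * (#|V|%:R * (#|V|%:R - 1)).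
  rewrite /A /c; move: mn m4 n6; clear; move: #|V| => n.
  case: m => [|[|m]] //; case: n => [|[|n]] // _ _ _.
  rewrite !subSS !subn0; have e1 := mul_bin_diag n.+2 m.+1; have e2 := mul_bin_diag n.+1 m.
  have -> : m.+2%:R - 1 = m.+1%:R :> R by rewrite -[m.+2]addn1 natrD addrK.
  have -> : n.+2%:R - 1 = n.+1%:R :> R by rewrite -[n.+2]addn1 natrD addrK.
  rewrite -!natrM; congr (_%:R); rewrite /= in e1 e2.
  by rewrite mulnA [(_ * m.+2)%N]mulnC -e1 -mulnA [(_ * m.+1)%N]mulnC -e2; ring.
have BE : B * ((#|V|%:R - 2) * (#|V|%:R - 3)) = c * ((m%:R - 2) * (m%:R - 3)).
  rewrite /B /c; move: mn m4 n6; clear; move: #|V| => n.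
  case: m => [|[|[|[|m]]]] //; case: n => [|[|[|[|n]]]] // _ _ _.
  rewrite !subSS !subn0; have e1 := mul_bin_diag n.+2 m.+1; have e2 := mul_bin_diag n.+1 m.
  have -> : m.+4%:R - 2 = m.+2%:R :> R by rewrite -[m.+4]addn2 natrD addrK.
  have -> : n.+4%:R - 2 = n.+2%:R :> R by rewrite -[n.+4]addn2 natrD addrK.
  have -> : m.+4%:R - 3 = m.+1%:R :> R by rewrite -[m.+4]addn3 natrD addrK.
  have -> : n.+4%:R - 3 = n.+1%:R :> R by rewrite -[n.+4]addn3 natrD addrK.
  rewrite -!natrM; congr (_%:R); rewrite /= in e1 e2.
  by rewrite mulnA [RHS]mulnA [in RHS](mulnC _ m.+2) -e1 -[RHS]mulnA [in RHS](mulnC _ m.+1) -e2; ring.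
have n6R : 6 <= #|V|%:R :> R by rewrite ler_nat.
have m4R : 4 <= m%:R :> R by rewrite ler_nat.
move: AE BE n6R m4R; set n : R := #|V|%:R; set M : R := m%:R => AE BE n6R m4R H.
rewrite -(ler_pM2l c0); apply: le_trans H _; rewrite [leRHS]mulrDr; apply: lerD.
  have -> : A * (G * M ^+ 2 + extremal_cst * M) =
      A * (M * (M - 1)) * (G + (G + extremal_cst) / (M - 1)).
    by field; apply: lt0r_neq0; lra.
  rewrite AE -mulrA ler_pM2l //; apply: ler_wpM2r; last by rewrite expr2; lra.
  by apply: addr_ge0 => //; apply: divr_ge0; [exact: addr_ge0 | lra].
have d0 : 0 < (n - 2) * (n - 3) by rewrite mulr_gt0; lra.
have -> : B = c * ((M - 2) * (M - 3)) / ((n - 2) * (n - 3)).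
  by rewrite -BE mulfK // gt_eqF.
have E1 d : c * ((M - 2) * (M - 3)) * d * b * (M ^+ 2 * l10) =
    c * ((M ^+ 2 * l10 * b) * ((M - 2) * (M - 3) * d)) by ring.
have E2 d : 3 * M ^+ 4 * l10 * (b * d) = (M ^+ 2 * l10 * b) * (3 * M ^+ 2 * d) by ring.
rewrite E1 E2 ler_pM2l //.
apply: ler_wpM2l; first by do 2!apply: mulr_ge0 => //; apply: sqr_ge0.
rewrite ler_pdivrMr // mulrAC ler_pdivlMr; last by rewrite exprn_gt0 //; lra.
have : (M - 2) * (M - 3) <= M ^+ 2 by rewrite expr2; nra.
(* This holds from [n = 6] on, with equality at 6. *)
have : n ^+ 2 <= 3 * ((n - 2) * (n - 3)) by rewrite expr2; nra.
move=> h1 h2.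
have M23 : 0 <= (M - 2) * (M - 3) by apply: mulr_ge0; lra.
have := ler_pM M23 (sqr_ge0 n) h2 h1.
by lra.
Qed.

End Supersaturation.

(** * Conditional expectations on a finite set *)

Section ConditionalExpectation.
Variables (R : realType) (X : finType) (F : {set X}) (K : eqType).
Implicit Types (k : X -> K) (f g : X -> R).

(* The expectation of [f] for the uniform measure on [F], given the key [k x]; it
   is 0 when no element of [F] has this key. *)
Definition cond_exp k f x : R :=
  (\sum_(y in F | k y == k x) f y) / #|[set y in F | k y == k x]|%:R.

(** Measurability of [g] with respect to the partition generated by [k]. *)
Definition determined (T : Type) k (g : X -> T) :=
  forall x y, k x = k y -> g x = g y.

Lemma cond_exp_determined k f : determined k (cond_exp k f).
Proof. by move=> x y E; rewrite /cond_exp E. Qed.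

Lemma determined_finer T k k' (g : X -> T) :
  determined k' k -> determined k g -> determined k' g.
Proof. by move=> kk gk x y /kk /gk. Qed.

Lemma class_gt0 k x : x \in F -> 0 < #|[set y in F | k y == k x]|%:R :> R.
Proof. by move=> xF; rewrite ltr0n card_gt0; apply/set0Pn; exists x; rewrite inE xF eqxx. Qed.

Lemma eq_cond_exp k f f' x :
  (forall y, y \in F -> k y = k x -> f y = f' y) -> cond_exp k f x = cond_exp k f' x.
Proof.
by move=> E; congr (_ / _); apply: eq_bigr => y /andP[yF /eqP yx]; apply: E.
Qed.

Lemma cond_exp_cst k (c : R) x : x \in F -> cond_exp k (fun=> c) x = c.
Proof.
move=> xF; rewrite /cond_exp sumr_const.
rewrite (_ : #|_| = #|[set y in F | k y == k x]|); last by apply: eq_card => y; rewrite !inE.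
by rewrite -[c *+ _]mulr_natr mulfK // gt_eqF // class_gt0.
Qed.

Lemma cond_exp_01 k f x : (forall y, 0 <= f y <= 1) -> 0 <= cond_exp k f x <= 1.
Proof.
move=> f01; have f0 y : 0 <= f y by case/andP: (f01 y).
rewrite /cond_exp divr_ge0 ?sumr_ge0 //=.
have : \sum_(y in F | k y == k x) f y <= #|[set y in F | k y == k x]|%:R.
  rewrite -sumr_const (eq_bigl (mem [set y in F | k y == k x])); last first.
    by move=> y; rewrite !inE.
  by apply: ler_sum => y _; case/andP: (f01 y).
case: (#|_|) => [|n] le; first by rewrite invr0 mulr0.
by rewrite ler_pdivrMr ?mul1r ?ltr0n.
Qed.

(** A factor determined by the key can be pulled out of the conditional expectation; then the tower
    property applies. *)
Lemma sum_cond_exp k f g : determined k g ->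
  \sum_(x in F) g x * cond_exp k f x = \sum_(x in F) g x * f x.
Proof.
move=> gk; rewrite /cond_exp.
under eq_bigr do rewrite mulr_suml mulr_sumr.
rewrite (exchange_big_dep (mem F)) /=; last by move=> x y _ /andP[].
apply: eq_bigr => y yF.
transitivity (\sum_(x in F | k y == k x) g y * (f y / #|[set z in F | k z == k y]|%:R)).
  apply: eq_big => [x|x]; first by rewrite yF.
  by case/andP=> xF /andP[_ /eqP yx]; rewrite (gk x y) ?yx.
rewrite sumr_const (_ : #|_| = #|[set z in F | k z == k y]|); last first.
  by apply: eq_card => z; rewrite !inE -topredE /= eq_sym.
by rewrite -[LHS]mulr_natr -mulrA divfK // gt_eqF // class_gt0.
Qed.

Lemma sum_cond_exp1 k f : \sum_(x in F) cond_exp k f x = \sum_(x in F) f x.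
Proof.
transitivity (\sum_(x in F) 1 * cond_exp k f x); first by apply: eq_bigr => x _; rewrite mul1r.
by rewrite sum_cond_exp //; apply: eq_bigr => x _; rewrite mul1r.
Qed.

(** Conditioning on the coarser key is an orthogonal projection, so an increase of energy is a
    squared distance. *)
Lemma cond_exp_pythagoras k k' f : determined k' k ->
  \sum_(x in F) (cond_exp k' f x - cond_exp k f x) ^+ 2 =
  \sum_(x in F) cond_exp k' f x ^+ 2 - \sum_(x in F) cond_exp k f x ^+ 2.
Proof.
move=> kk'.
have pk : determined k (cond_exp k f) by exact: cond_exp_determined.
have E : \sum_(x in F) cond_exp k f x * cond_exp k' f x = \sum_(x in F) cond_exp k f x ^+ 2.
  rewrite sum_cond_exp; last exact: determined_finer kk' pk.
  by rewrite -(sum_cond_exp f pk); apply: eq_bigr => x _; rewrite expr2.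
transitivity (\sum_(x in F) (cond_exp k' f x ^+ 2 - 2 * (cond_exp k f x * cond_exp k' f x) +
    cond_exp k f x ^+ 2)); first by apply: eq_bigr => x _; ring.
by rewrite big_split sumrB /= -mulr_sumr E; ring.
Qed.

(* The factors are replaced one at a time by their conditional expectations:
   all the others are determined by the finer key [k' i]. *)
Lemma cond_exp_prod (I : eqType) (s : seq I) k (k' : I -> X -> K) (f : I -> X -> R) g :
  uniq s -> (forall i, determined (k' i) k) ->
  (forall i j, i \in s -> j \in s -> i != j -> determined (k' i) (f j)) ->
  (forall i x, 0 <= f i x <= 1) -> determined k g -> (forall x, 0 <= g x <= 1) ->
  \sum_(x in F) g x * \prod_(i <- s) cond_exp k (f i) x <=
  \sum_(x in F) g x * \prod_(i <- s) f i x +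
  \sum_(i <- s) \sum_(x in F) `|cond_exp (k' i) (f i) x - cond_exp k (f i) x|.
Proof.
move=> Us kk' fk f01; elim: s Us fk g => [|i s IH] /= Us fk g gk g01.
  by rewrite big_nil addr0; under [leRHS]eq_bigr do rewrite big_nil; under eq_bigr do rewrite big_nil.
case/andP: Us => ns Us.
have fk' j l : j \in s -> l \in s -> j != l -> determined (k' j) (f l).
  by move=> js ls; apply: fk; rewrite inE ?js ?ls orbT.
have p01 x := cond_exp_01 k x (f01 i).
under eq_bigr do rewrite big_cons mulrA.
under [X in _ <= X + _]eq_bigr do rewrite big_cons.
rewrite big_cons.
(* The conditional expectation of the first factor is determined by [k], so it joins the weight [g]
   in the induction hypothesis. *)
have g'01 x : 0 <= g x * cond_exp k (f i) x <= 1.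
  case/andP: (g01 x) (p01 x) => g0 g1 /andP[p0 p1].
  by rewrite mulr_ge0 // mulr_ile1.
have g'k : determined k (fun x => g x * cond_exp k (f i) x).
  by move=> x y xy; rewrite (gk _ _ xy) (cond_exp_determined (f i) xy).
apply: le_trans (IH Us fk' _ g'k g'01) _.
rewrite addrA lerD2r.
have prod01 x : 0 <= \prod_(j <- s) f j x <= 1.
  elim: {IH Us fk fk' ns} s => [|j s /andP[IH0 IH1]]; rewrite ?big_nil ?ler01 ?lexx //.
  by rewrite big_cons; case/andP: (f01 j x) => *; rewrite mulr_ge0 // mulr_ile1.
have -> : \sum_(x in F) g x * (f i x * \prod_(j <- s) f j x) =
    \sum_(x in F) (g x * \prod_(j <- s) f j x) * cond_exp (k' i) (f i) x.
  rewrite sum_cond_exp; first by apply: eq_bigr => x _; ring.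
  move=> x y xy; rewrite (gk x y) ?(kk' i x y) //; congr (_ * _).
  rewrite [LHS]big_seq [RHS]big_seq; apply: eq_bigr => j js.
  apply: (fk i j) => //; rewrite ?inE ?eqxx ?js ?orbT //.
  by apply: contraNneq ns => ->.
rewrite -big_split /=; apply: ler_sum => x _.
have /andP[G0 G1] : 0 <= g x * \prod_(j <- s) f j x <= 1.
  by case/andP: (g01 x) (prod01 x) => g0 g1 /andP[p0 p1]; rewrite mulr_ge0 // mulr_ile1.
rewrite -mulrA [_ * \prod_(_ <- _) _]mulrC mulrA -lerBlDl -mulrBr.
rewrite (distrC (cond_exp _ _ _)) (le_trans (ler_norm _)) // normrM ger0_norm //.
by rewrite ler_piMl.
Qed.

End ConditionalExpectation.

(** * Entropy and energy increment *)

Section Restriction.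
Variables (E : finType) (p : nat).
Local Notation C := 'I_p.+1.
Local Notation X := {ffun E -> C}.

(** Unrevealed coordinates are set to [ord0], so that a restriction stays in the same type and
    serves as a key. *)
Definition restr (D : {set E}) (x : X) : X := [ffun e => if e \in D then x e else ord0].

Lemma restrP (D : {set E}) (x y : X) :
  restr D x = restr D y <-> {in D, x =1 y}.
Proof.
split=> [/ffunP H e eD|H]; first by have := H e; rewrite !ffunE eD.
by apply/ffunP => e; rewrite !ffunE; case: ifP => // eD; apply: H.
Qed.

Lemma restr_id D x : restr D (restr D x) = restr D x.
Proof. by apply/restrP => e eD; rewrite ffunE eD. Qed.

Lemma restr_finer (D D' : {set E}) : D \subset D' -> determined (restr D') (restr D).
Proof. by move=> /subsetP DD x y /restrP H; apply/restrP => e /DD; apply: H. Qed.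

Variable (R : realType).

(** Group the [x] by their restriction [z], of which there are [p.+1 ^ #|D|]. For fixed [z],
    extending the sum to all [x] gives the product of the [\sum_c q z e c]. *)
Lemma sum_prod_restr_le (D : {set E}) (q : X -> E -> C -> R) :
  (forall z e c, 0 <= q z e c) -> (forall z e, \sum_c q z e c <= 1) ->
  \sum_x \prod_e q (restr D x) e (x e) <= p.+1%:R ^+ #|D|.
Proof.
move=> q0 q1; pose Z := [pred z : X | z \in pffun_on (ord0 : C) D predT].
rewrite (partition_big (restr D) Z) /=; last first.
  move=> x _; apply/pffun_onP; split=> //; apply/subsetP => e.
  by rewrite inE ffunE; case: ifP => // _; rewrite eqxx.
have -> : p.+1%:R ^+ #|D| = \sum_(z | Z z) 1 :> R.
  by rewrite sumr_const card_pffun_on cardT size_enum_ord natrX.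
apply: ler_sum => z _.
apply: (@le_trans _ _ (\sum_(x : X) \prod_e q z e (x e))).
  rewrite big_mkcond; apply: ler_sum => x _; case: eqP => [<-|_] //.
  by apply: prodr_ge0.
rewrite -(bigA_distr_bigA (fun e c => q z e c)); apply: prodr_ile1 => e _.
by rewrite q1 sumr_ge0.
Qed.

(* Gibbs' inequality for the uniform distribution on [F] against the
   distribution that is uniform on the restrictions to [D] and, given the
   restriction, has independent coordinates with laws [q]. *)
Lemma gibbs_restr (F : {set X}) (D : {set E}) (q : X -> E -> C -> R) :
  F != set0 -> (forall z e c, 0 < q z e c) -> (forall z e, \sum_c q z e c <= 1) ->
  #|F|%:R * ln #|F|%:R <=
  \sum_(x in F) (#|D|%:R * ln p.+1%:R - \sum_e ln (q (restr D x) e (x e))).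
Proof.
move=> F0 q0 q1; set N : R := #|F|%:R; set B : R := p.+1%:R ^+ #|D|.
have N0 : 0 < N by rewrite ltr0n card_gt0.
have B0 : 0 < B by rewrite exprn_gt0 // ltr0n.
pose Q (x : X) : R := \prod_e q (restr D x) e (x e).
have Q0 x : 0 < Q x by apply: prodr_gt0.
have lnQ x : ln (Q x) = \sum_e ln (q (restr D x) e (x e)) by exact: ln_prod.
(* This is [ln s <= s - 1] for [s] the ratio of the reference weight [Q x / B] to the uniform weight
   [1 / N]; summed over [F], the right side is at most 0. *)
have key x : ln N - (#|D|%:R * ln p.+1%:R - ln (Q x)) <= N * Q x / B - 1.
  have h : 0 < N * Q x / B by rewrite divr_gt0 ?mulr_gt0.
  have : ln (1 + (N * Q x / B - 1)) <= N * Q x / B - 1 by apply: le_ln1Dx; lra.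
  rewrite [1 + _]addrC subrK; apply: le_trans.
  rewrite lnM ?posrE ?invr_gt0 ?mulr_gt0 // lnV ?posrE // lnM ?posrE //.
  by rewrite /B lnXn ?ltr0n // mulr_natl; lra.
have : \sum_(x in F) (ln N - (#|D|%:R * ln p.+1%:R - ln (Q x))) <= \sum_(x in F) (N * Q x / B - 1).
  by apply: ler_sum => x _; exact: key.
have sumQ : \sum_(x in F) Q x <= B.
  apply: le_trans (sum_prod_restr_le D (fun z e c => ltW (q0 z e c)) q1).
  rewrite big_mkcond; apply: ler_sum => x _.
  by case: ifP => _; [exact: lexx | exact: ltW (Q0 x)].
have R0 : \sum_(x in F) (N * Q x / B - 1) <= 0.
  rewrite sumrB sumr_const -/N -mulr_suml -mulr_sumr subr_le0 ler_pdivrMr //.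
  by rewrite ler_pM2l.
move=> /le_trans /(_ R0); rewrite sumrB subr_le0 sumr_const -[_ *+ _]mulr_natl.
by under eq_bigr do rewrite lnQ.
Qed.

End Restriction.

(** * Conditional tails and caps *)

Section Caps.
Variables (R : realType) (E : finType) (p : nat).
Local Notation X := {ffun E -> 'I_p.+1}.
Variable F : {set X}.
Implicit Types (D : {set E}) (x : X) (e : E).

(** The conditional probability, given the coordinates in [D], that coordinate [e] is at least
    [c]. *)
Definition tail D x e (c : nat) : R :=
  cond_exp F (restr D) (fun y => (c <= y e)%N%:R) x.

(** For [x] in [F] and [delta <= 1] the value 0 always qualifies, so the maximum is attained by a
    [c] of tail at least [delta]. *)
Definition cap D (delta : R) x e : nat :=
  \max_(c < p.+1 | delta <= tail D x e c) c.

Lemma tail01 D x e c : 0 <= tail D x e c <= 1.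
Proof. by apply: cond_exp_01 => y; rewrite ler0n lern1 leq_b1. Qed.

Lemma cap_le D delta x e : (cap D delta x e <= p)%N.
Proof. by apply/bigmax_leqP => c _; rewrite -ltnS. Qed.

Lemma cap_determined D delta : determined (restr D) (cap D delta).
Proof.
move=> x y xy; apply/boolp.funext => e; apply: eq_bigl => c.
by rewrite /tail (cond_exp_determined F _ xy).
Qed.

Lemma cap_restr D delta x : cap D delta (restr D x) = cap D delta x.
Proof. by apply: cap_determined; rewrite restr_id. Qed.

Lemma tail_cap D delta x e : x \in F -> delta <= 1 -> delta <= tail D x e (cap D delta x e).
Proof.
move=> xF d1; have t0 : delta <= tail D x e (@ord0 p) by rewrite /tail cond_exp_cst.
rewrite /cap (bigop.bigmax_eq_arg _ (P := fun c : 'I_p.+1 => delta <= tail D x e c) t0).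
by case: arg_maxnP.
Qed.

Lemma tail_above D delta x e c : (c <= p)%N -> (cap D delta x e < c)%N -> tail D x e c < delta.
Proof.
move=> cp capc; rewrite ltNge; apply: contraL capc => dt; rewrite -leqNgt.
by rewrite -ltnS in cp; apply: (leq_bigmax_cond (Ordinal cp)).
Qed.

(** Given the restriction to [D] the cap is constant, and by its maximality the tail at the next
    value is below [delta]; a cap equal to [p] cannot be exceeded. *)
Lemma sum_exceed D delta e : 0 <= delta ->
  \sum_(x in F) (cap D delta x e < x e)%N%:R <= #|F|%:R * delta.
Proof.
move=> d0; rewrite -(sum_cond_exp1 F (restr D)).
rewrite mulr_natl -sumr_const; apply: ler_sum => x xF.
rewrite (@eq_cond_exp _ _ _ _ _ _ (fun y : X => (cap D delta x e < y e)%N%:R)); last first.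
  by move=> y _ yx; rewrite (cap_determined delta yx).
have [lt|ge] := ltnP (cap D delta x e) p; first exact/ltW/(tail_above lt).
rewrite (@eq_cond_exp _ _ _ _ _ _ (fun=> 0)) ?cond_exp_cst // => y _ _.
by rewrite ltnNge (leq_trans _ ge) // -ltnS.
Qed.

(** In [gibbs_restr] take for [q] the law that spreads mass [1 - theta] evenly up to the cap and
    gives each value above it mass [theta / p.+1]. *)
Lemma gibbs_cap D (delta theta : R) : F != set0 -> 0 < theta < 1 ->
  #|F|%:R * ln #|F|%:R <=
  \sum_(x in F) (#|D|%:R * ln p.+1%:R + \sum_e (ln (cap D delta x e).+1%:R
     - ln (1 - theta) + (cap D delta x e < x e)%N%:R * ln (p.+1%:R / theta))).
Proof.
move=> F0 /andP[t0 t1].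
pose q (z : X) e (c : 'I_p.+1) : R :=
  if (c <= cap D delta z e)%N then (1 - theta) / (cap D delta z e).+1%:R else theta / p.+1%:R.
have q0 z e c : 0 < q z e c.
  by rewrite /q; case: ifP => _; rewrite divr_gt0 ?ltr0n ?subr_gt0.
have q1 z e : \sum_c q z e c <= 1.
  rewrite (bigID (fun c : 'I_p.+1 => (c < (cap D delta z e).+1)%N)) /=.
  apply: (@le_trans _ _ ((1 - theta) + theta)); last by lra.
  apply: lerD.
    rewrite (eq_bigr (fun=> (1 - theta) / (cap D delta z e).+1%:R)); last first.
      by move=> c; rewrite ltnS /q => ->.
    rewrite -(big_ord_widen _ (fun=> (1 - theta) / (cap D delta z e).+1%:R)); last first.
      by rewrite ltnS cap_le.
    by rewrite sumr_const card_ord -[X in X <= _]mulr_natr divfK // pnatr_eq0.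
  apply: (@le_trans _ _ (\sum_(c < p.+1) theta / p.+1%:R)).
    rewrite big_mkcond; apply: ler_sum => c _; rewrite ltnS /q.
    by case: (c <= _)%N => //=; rewrite divr_ge0 // ltW.
  by rewrite sumr_const card_ord -[X in X <= _]mulr_natr divfK // pnatr_eq0.
apply: le_trans (gibbs_restr D F0 q0 q1) _; apply: ler_sum => x xF.
rewrite lerD2l -sumrN; apply: ler_sum => e _; rewrite /q cap_restr.
have l1 : ln (1 - theta) <= 0 by apply: ln_le0; lra.
case: leqP => cx.
  by rewrite ln_div ?posrE ?ltr0n ?subr_gt0 // mul0r; lra.
rewrite mul1r -[- ln (theta / _)]lnV ?posrE ?divr_gt0 ?ltr0n // invf_div.
by rewrite lerDr; have := ln_nat_ge0 R (cap D delta x e).+1; lra.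
Qed.

End Caps.

(** * Energy increment and bad 4-sets of the cap multigraph *)

Section Counting.
Variables (R : realType) (V : finType).
Local Notation X := {ffun pairs V -> 'I_10}.
Local Notation N F := (#|F : {set X}|%:R : R).
Implicit Types (S Y : {set V}) (F : {set X}) (x : X) (e : pairs V).

(** For bounded [#|S|] there are only linearly many such pairs, so revealing them is free at the
    scale [n ^ 2]. *)
Definition touch S : {set pairs V} := [set e : pairs V | ~~ [disjoint val e & S]].

Lemma touchS S S' : S \subset S' -> touch S \subset touch S'.
Proof.
move=> SS; apply/subsetP => e; rewrite !inE; apply: contra; exact: disjointWr.
Qed.

Lemma card_touch S : (#|touch S| <= #|S| * #|V|)%N.
Proof.
rewrite -cardsT -cardsX -(card_imset _ val_inj).
apply: leq_trans (leq_imset_card (fun q : V * V => [set q.1; q.2]) _).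
apply: subset_leq_card; apply/subsetP => _ /imsetP[e + ->]; rewrite inE => /pred0Pn[a /andP[ae aS]].
have /cards2P[b [c [bc eE]]] := valP e.
have {}aS : a \in S by exact: aS.
have {ae} : a \in val e by exact: ae.
rewrite eE !inE => /orP[] /eqP aE; apply/imsetP.
  by exists (a, c); [rewrite !inE /= aS | rewrite aE].
by exists (a, b); [rewrite !inE /= aS | rewrite aE setUC].
Qed.

(** Not normalized: it lies between 0 and ten times the number of members of [F] times the number of
    pairs. *)
Definition energy F S : R :=
  \sum_(x in F) \sum_(e : pairs V) \sum_(c < 10) tail R F (touch S) x e c ^+ 2.

Lemma energy_diff F S S' : S \subset S' ->
  \sum_(e : pairs V) \sum_(x in F) \sum_(c < 10)
    (tail R F (touch S') x e c - tail R F (touch S) x e c) ^+ 2 = energy F S' - energy F S.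
Proof.
move=> /touchS /restr_finer SS; rewrite /energy [X in _ = X - _]exchange_big.
rewrite [X in _ = _ - X]exchange_big -sumrB /=; apply: eq_bigr => e _.
rewrite exchange_big [X in _ = X - _]exchange_big [X in _ = _ - X]exchange_big /=.
rewrite -sumrB; apply: eq_bigr => c _; exact: cond_exp_pythagoras.
Qed.

(* [S] maximizes the energy minus a penalty linear in [#|S|]. *)
Lemma energy_choice F (eps : R) : F != set0 -> (0 < #|{: pairs V}|)%N -> 0 < eps ->
  exists S, eps * #|S|%:R <= 10 /\ forall Y, #|Y| = 2%N ->
   energy F (S :|: Y) - energy F S <= 2 * eps * (N F * #|{: pairs V}|%:R).
Proof.
move=> F0 E0 eps0; set M : R := N F * _.
have M0 : 0 < M by rewrite mulr_gt0 // ltr0n // card_gt0.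
have [S _ Smax] := @arg_maxP _ R _ set0 predT (fun S => energy F S - eps * M * #|S|%:R) isT.
have eM : 0 < eps * M by rewrite mulr_gt0.
exists S; split=> [|Y Y2].
  (* Comparison with the empty set bounds [#|S|]; comparison with [S :|: Y] below bounds the energy
     gain. *)
  have le0 : energy F set0 <= energy F S - eps * M * #|S|%:R.
    by have := Smax set0 isT; rewrite cards0 mulr0 subr0.
  have : 0 <= energy F set0 by do 3![apply: sumr_ge0 => ? _]; exact: sqr_ge0.
  have : energy F S <= 10 * M.
    apply: (@le_trans _ _ (\sum_(x in F) \sum_(e : pairs V) \sum_(c < 10) 1)).
      apply: ler_sum => x _; apply: ler_sum => e _; apply: ler_sum => c _.
      by have /andP[t0 t1] := tail01 R F (touch S) x e c; rewrite expr_le1.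
    rewrite !sumr_const card_ord -!mulrnA /M -!natrM ler_nat leq_eqVlt.
    by apply/orP; left; apply/eqP; ring.
  by move=> leM ge0; rewrite -(ler_pM2l M0); move: le0 leM ge0; clear; lra.
have le : energy F (S :|: Y) - eps * M * #|S :|: Y|%:R <= energy F S - eps * M * #|S|%:R.
  exact: Smax (S :|: Y) isT.
have : eps * M * #|S :|: Y|%:R <= eps * M * (#|S|%:R + 2).
  rewrite ler_pM2l // -natrD ler_nat -Y2 cardsU leq_subr //.
by lra.
Qed.

Lemma card_pairs_sub Y : #|Y| = 4%N -> #|[set e : pairs V | val e \subset Y]| = 6%N.
Proof.
move=> Y4; rewrite -(card_imset _ val_inj).
transitivity #|[set A : {set V} | (A \subset Y) && (#|A| == 2%N)]|.
  apply: eq_card => A; rewrite inE; apply/imsetP/andP => [[e]|[AY A2]].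
    by rewrite inE => eY ->; rewrite eY; case: e {eY}.
  by exists (Sub A A2); rewrite ?inE ?SubK.
by rewrite cards_draws Y4.
Qed.

(** A finite model of the multigraphs to be counted: for at least four vertices every pair lies in a
    4-set, so its multiplicity is at most 9 and fits in ['I_10]. *)
Definition sparse49 : {set X} := [set x : X | [forall Y : {set V}, (#|Y| == 4%N) ==>
  (\sum_(e : pairs V | val e \subset Y) x e <= 9)%N]].

Let F := sparse49.

(** If [Y] is bad for the cap, each event [cap e <= x e] with [e] inside [Y] has conditional
    probability at least [delta]. Independence would let all six occur together with probability at
    least [delta ^ 6], yet no [x] in [F] allows this. The right side bounds the defect of
    independence from [cond_exp_prod]. *)
Lemma bad4_quad (S Y : {set V}) (delta tau : R) : 0 < delta <= 1 -> 0 < tau -> #|Y| = 4%N ->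
  delta ^+ 6 * \sum_(x in F) (Y \in bad4 (cap F (touch S) delta x))%:R <=
  \sum_(e : pairs V | val e \subset Y) (tau^-1 * \sum_(x in F) \sum_(c < 10)
    (tail R F (touch (S :|: (Y :\: val e))) x e c - tail R F (touch S) x e c) ^+ 2
    + tau * N F).
Proof.
move=> /andP[d0 d1] tau0 Y4.
pose f e x : R := (cap F (touch S) delta x e <= x e)%N%:R.
pose g x : R := (Y \in bad4 (cap F (touch S) delta x))%:R.
pose k' e : X -> X := restr (touch (S :|: (Y :\: val e))).
pose s := enum [set e : pairs V | val e \subset Y].
have memS e : (e \in s) = (val e \subset Y) by rewrite mem_enum inE.
have kk' e : determined (k' e) (restr (touch S)).
  by apply: restr_finer; apply: touchS; apply: subsetUl.
have capk : determined (restr (touch S)) (cap F (touch S) delta).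
  exact: cap_determined.
have gk : determined (restr (touch S)) g.
  by move=> x y /capk E; rewrite /g E.
have fe e x : cond_exp F (restr (touch S)) (f e) x = tail R F (touch S) x e (cap F (touch S) delta x e).
  by apply: eq_cond_exp => y _ /capk E; rewrite /f E.
have fe' e x : cond_exp F (k' e) (f e) x =
    tail R F (touch (S :|: (Y :\: val e))) x e (cap F (touch S) delta x e).
  by apply: eq_cond_exp => y _ /kk' /capk E; rewrite /f E.
have := @cond_exp_prod R X F X _ s (restr (touch S)) k' f g (enum_uniq _) kk'.
have f01 e x : 0 <= f e x <= 1 by rewrite /f ler0n lern1 leq_b1.
have g01 x : 0 <= g x <= 1 by rewrite /g ler0n lern1 leq_b1.
(* A pair [e'] inside [Y] other than [e] has a vertex in [Y :\: val e], so it is revealed by the key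
   [k' e]. *)
have fk e e' : e \in s -> e' \in s -> e != e' -> determined (k' e) (f e').
  rewrite !memS => eY e'Y ee' x y xy; rewrite /f (capk _ _ (kk' _ _ _ xy)).
  move/restrP: xy => -> //; rewrite inE; apply: contra ee' => dis.
  rewrite -val_eqE eq_sym eqEcard (eqP (valP e)) (eqP (valP e')) leqnn andbT.
  apply/subsetP => v ve'; apply/negPn/negP => nve.
  move/pred0P: dis => /(_ v) /=; rewrite ve' !inE nve (subsetP e'Y _ ve') orbT.
  by [].
move=> /(_ fk f01 gk g01).
have -> : \sum_(x in F) g x * \prod_(e <- s) f e x = 0.
  apply: big1 => x; rewrite inE => /forallP/(_ Y); rewrite Y4 eqxx /= => x9.
  rewrite /g; have [|] := boolP (Y \in _); last by rewrite mul0r.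
  rewrite inE Y4 eqxx /= ltnNge => bad; rewrite mul1r.
  have [/hasP[e es fe0]|/hasPn H] := boolP (has (fun e => f e x == 0) s).
    by rewrite (big_rem e) //= (eqP fe0) mul0r.
  case/negP: bad; apply: leq_trans x9; apply: leq_sum => e eY.
  have := H e; rewrite memS => /(_ eY); rewrite /f pnatr_eq0.
  by case: leqP.
rewrite add0r => main.
apply: (@le_trans _ _ (\sum_(x in F) g x * \prod_(e <- s) cond_exp F (restr (touch S)) (f e) x)).
  rewrite mulr_sumr; apply: ler_sum => x xF; rewrite mulrC.
  apply: ler_wpM2l; first by case/andP: (g01 x).
  have -> : delta ^+ 6 = \prod_(e <- s) delta.
    by rewrite big_const_seq count_predT -cardE card_pairs_sub // /= mulr1.
  apply: ler_prod => e _; rewrite (ltW d0) fe; exact: tail_cap.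
apply: le_trans main _.
rewrite /s big_enum /= big_set /=; apply: ler_sum => e eY.
rewrite (mulr_natr tau) -sumr_const mulr_sumr -big_split /=; apply: ler_sum => x xF.
rewrite fe fe'.
have cp : (cap F (touch S) delta x e < 10)%N by rewrite ltnS cap_le.
rewrite (bigD1 (Ordinal cp)) //=.
set u := _ - _; set r := \sum_(_ < _ | _) _.
have r0 : 0 <= r by apply: sumr_ge0 => c _; apply: sqr_ge0.
(* The absolute value is at most [u ^ 2 / tau + tau], which brings in the squares that the energy
   controls. *)
apply: (@le_trans _ _ (tau^-1 * u ^+ 2 + tau)); last first.
  by rewrite lerD2r ler_pM2l ?invr_gt0 // lerDl.
have -> : u ^+ 2 = `|u| ^+ 2 by rewrite real_normK ?num_real.
have ti : tau * tau^-1 = 1 by rewrite divff // gt_eqF.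
rewrite -(ler_pM2l tau0) mulrDr mulrA ti mul1r.
have : 0 <= (`|u| - tau) ^+ 2 by apply: sqr_ge0.
have : 0 <= `|u| * tau by rewrite mulr_ge0 // ltW.
by rewrite !expr2; lra.
Qed.

(** A 4-set [Y] containing [e] is recovered from [Y :\: val e] and [e]. *)
Lemma sum_quads_le (h : {set V} -> pairs V -> R) : (forall Y e, 0 <= h Y e) ->
  \sum_(Y : {set V} | #|Y| == 4%N) \sum_(e : pairs V | val e \subset Y) h (Y :\: val e) e <=
  \sum_(Y : {set V} | #|Y| == 2%N) \sum_(e : pairs V) h Y e.
Proof.
move=> h0; rewrite (exchange_big_dep xpredT) //= [leRHS]exchange_big /=.
apply: ler_sum => e _.
have e2 := eqP (valP e).
rewrite (partition_big (fun Y => Y :\: val e) (fun Z : {set V} => #|Z| == 2%N)) /=; last first.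
  by move=> Y /andP[/eqP Y4 eY]; rewrite cardsD (setIidPr eY) Y4 e2.
apply: ler_sum => Z _.
rewrite (eq_bigr (fun=> h Z e)); last by move=> Y /andP[_ /eqP ->].
rewrite sumr_const -[leLHS]mulr_natr ler_piMr // -[1]/(1%:R) ler_nat.
apply: (@leq_trans #|[set Z :|: val e]|); last by rewrite cards1.
apply: subset_leq_card; apply/subsetP => Y; rewrite inE => /andP[/andP[_ eY] /eqP <-].
by rewrite -[X in _ :|: X](setIidPr eY) setUC setID.
Qed.

(** Sum [bad4_quad] over all [Y]. The squares regroup by the two-vertex sets [Y :\: val e], at most
    [n ^ 2] in number, each giving an energy gain; the terms [tau] occur six times per 4-set. *)
Lemma bad4_total (S : {set V}) (delta tau eps : R) : 0 < delta <= 1 -> 0 < tau ->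
  (forall Y, #|Y| = 2%N ->
     energy F (S :|: Y) - energy F S <= 2 * eps * (N F * #|{: pairs V}|%:R)) -> 0 < eps ->
  delta ^+ 6 * \sum_(x in F) #|bad4 (cap F (touch S) delta x)|%:R <=
  (2 * eps / tau + 6 * tau) * (N F * #|V|%:R ^+ 4).
Proof.
move=> d01 tau0 Sen eps0.
have -> : \sum_(x in F) #|bad4 (cap F (touch S) delta x)|%:R =
    \sum_(Y : {set V} | #|Y| == 4%N) \sum_(x in F) (Y \in bad4 (cap F (touch S) delta x))%:R :> R.
  rewrite [RHS]exchange_big /=; apply: eq_bigr => x _; rewrite -natr_sum -sum1_card; congr (_%:R).
  rewrite big_mkcond [RHS]big_mkcond /=; apply: eq_bigr => Y _.
  by rewrite inE; case: eqP => //=; case: ltnP.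
have nV k : 'C(#|V|, k)%:R <= #|V|%:R ^+ k :> R.
  rewrite -natrX ler_nat -[leqLHS]mul1n; apply: leq_trans (leq_mul (fact_gt0 k) (leqnn _)) _.
  by rewrite mulnC bin_ffact; elim: k => [|k IH] //; rewrite ffactnSr expnSr leq_mul // leq_subr.
have card_sets k : #|[set Y : {set V} | #|Y| == k]|%:R <= #|V|%:R ^+ k :> R.
  apply: le_trans (nV k); rewrite ler_nat -[in 'C(_, _)](cardsT V) -cards_draws.
  by apply: subset_leq_card; apply/subsetP => Y; rewrite !inE subsetT.
rewrite mulr_sumr.
apply: le_trans; first by apply: ler_sum => Y Y4; exact: (bad4_quad S d01 tau0 (eqP Y4)).
under eq_bigr do rewrite big_split /= -mulr_sumr.
rewrite big_split /= -mulr_sumr mulrDl; apply: lerD.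
  pose h Y e := \sum_(x in F) \sum_(c < 10)
    (tail R F (touch (S :|: Y)) x e c - tail R F (touch S) x e c) ^+ 2.
  have h0 Y e : 0 <= h Y e by do 2![apply: sumr_ge0 => ? _]; apply: sqr_ge0.
  have := sum_quads_le h0; rewrite /h => le.
  rewrite [2 * eps / tau]mulrC -mulrA ler_pM2l ?invr_gt0 //.
  apply: le_trans le _.
  apply: (@le_trans _ _ (\sum_(Y : {set V} | #|Y| == 2%N) 2 * eps * (N F * #|{: pairs V}|%:R))).
    apply: ler_sum => Y /eqP Y2; rewrite energy_diff ?subsetUl //; exact: Sen.
  have cE : #|{: pairs V}|%:R <= #|V|%:R ^+ 2 :> R.
    apply: le_trans (card_sets 2%N); rewrite ler_nat -(card_imset _ val_inj).
    by apply: subset_leq_card; apply/subsetP => _ /imsetP[e _ ->]; rewrite inE (valP e).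
  rewrite sumr_const -[leLHS]mulr_natl.
  rewrite (_ : #|_| = #|[set Y : {set V} | #|Y| == 2%N]|); last by apply: eq_card => Y; rewrite inE.
  have -> : 2 * eps * (N F * #|V|%:R ^+ 4) = #|V|%:R ^+ 2 * (2 * eps * (N F * #|V|%:R ^+ 2)).
    by ring.
  apply: ler_pM => //; first by rewrite !mulr_ge0 // ltW.
  by rewrite ler_pM2l ?mulr_gt0 // ler_wpM2l.
under eq_bigr do rewrite -big_set sumr_const.
apply: (@le_trans _ _ (\sum_(Y : {set V} | #|Y| == 4%N) tau * N F *+ 6)).
  by apply: ler_sum => Y /eqP Y4; rewrite card_pairs_sub.
rewrite sumr_const -[leLHS]mulr_natl -[_ *+ 6]mulr_natl.
rewrite (_ : #|_| = #|[set Y : {set V} | #|Y| == 4%N]|); last by apply: eq_card => Y; rewrite inE.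
rewrite [leRHS]mulrA [leRHS]mulrC -[6 * tau * N F]mulrA.
by rewrite ler_wpM2r // !mulr_ge0 // ltW.
Qed.

End Counting.

(** * Upper and lower bounds *)

Section Upper.
Variables (R : realType) (V : finType).
Local Notation X := {ffun pairs V -> 'I_10}.
Local Notation n := (#|V|%:R : R).
Let F : {set X} := sparse49 V.

Lemma card_pairs : #|{: pairs V}| = 'C(#|V|, 2).
Proof.
rewrite -(card_imset _ val_inj) -[in 'C(_, _)](cardsT V) -cards_draws.
apply: eq_card => A; rewrite inE subsetT; apply/imsetP/idP => [[e _ ->]|A2]; first exact: (valP e).
by exists (Sub A A2); rewrite ?SubK.
Qed.

Lemma card_pairs_le : #|{: pairs V}|%:R <= n ^+ 2.
Proof.
rewrite card_pairs -natrX ler_nat; have := bin_ffact #|V| 2; rewrite ffactnS ffactn1 => E.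
apply: (@leq_trans ('C(#|V|, 2) * 2`!)); first by rewrite leq_pmulr.
by rewrite E -mulnn leq_mul // leq_pred.
Qed.

Lemma sparse49_neq0 : F != set0.
Proof.
apply/set0Pn; exists [ffun=> ord0]; rewrite inE; apply/forallP => Y; apply/implyP => _.
by rewrite big1 // => e _; rewrite ffunE.
Qed.

(** [gibbs_cap] with [D = touch S]: the revealed pairs cost the term linear in [n],
    [supersaturation] and [bad4_total] bound the mean of the [ln (cap e + 1)], and [sum_exceed]
    bounds the rest. *)
Lemma ln_card_sparse49_le (eps delta theta tau : R) (m : nat) :
  0 < eps -> 0 < delta <= 1 -> 0 < theta < 1 -> 0 < tau -> (4 <= m <= #|V|)%N -> (6 <= #|V|)%N ->
  ln #|F|%:R <= n * (10 / eps * ln 10) +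
    n ^+ 2 * (gamma * ln 2 + (gamma * ln 2 + extremal_cst R) / (m%:R - 1)
      + 3 * m%:R ^+ 4 * ln 10 * ((2 * eps / tau + 6 * tau) / delta ^+ 6)
      + (delta * ln (10 / theta) - ln (1 - theta))).
Proof.
move=> eps0 d01 t01 tau0 mn n6; have F0 := sparse49_neq0.
have /andP[d0 d1] := d01; have /andP[t0 t1] := t01.
have N0 : 0 < #|F|%:R :> R by rewrite ltr0n card_gt0.
have n0 : 0 < n by rewrite ltr0n (leq_trans _ n6).
have E0 : (0 < #|{: pairs V}|)%N by rewrite card_pairs bin_gt0 (leq_trans _ n6).
have [S [Seps Sen]] := energy_choice F0 E0 eps0.
have bad := bad4_total d01 tau0 Sen eps0; rewrite -/F in bad.
pose w x := cap F (touch S) delta x.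
have := gibbs_cap (touch S) delta F0 t01.
set l10 : R := ln 10; set lt : R := ln (10 / theta); set l1 := ln (1 - theta).
have l10_0 : 0 <= l10 by exact: ln_nat_ge0.
have lt0 : 0 <= lt by apply: ln_ge0; rewrite ler_pdivlMr //; lra.
have l1_0 : l1 <= 0 by apply: ln_le0; lra.
rewrite big_split /=; under [X in _ <= _ + X]eq_bigr do rewrite !big_split /=.
rewrite !big_split /= => main.
rewrite -(ler_pM2l N0); apply: (le_trans main); rewrite mulrDr; apply: lerD.
  rewrite sumr_const -[leLHS]mulr_natl ler_pM2l // mulrA ler_wpM2r //.
  have : #|touch S|%:R <= #|S|%:R * n by rewrite -natrM ler_nat card_touch.
  move/le_trans; apply; rewrite [leRHS]mulrC ler_wpM2r ?ler0n //.
  by rewrite ler_pdivlMr // mulrC.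
have h2 : \sum_(x in F) \sum_(e : pairs V) - l1 <= #|F|%:R * (n ^+ 2 * - l1).
  rewrite sumr_const -[leLHS]mulr_natl ler_pM2l // sumr_const -[leLHS]mulr_natl.
  by rewrite ler_wpM2r ?oppr_ge0 // card_pairs_le.
have h3 : \sum_(x in F) \sum_(e : pairs V) (w x e < x e)%N%:R * lt <=
    #|F|%:R * (n ^+ 2 * (delta * lt)).
  rewrite exchange_big /=.
  apply: (@le_trans _ _ (\sum_(e : pairs V) (#|F|%:R * delta) * lt)).
    by apply: ler_sum => e _; rewrite -mulr_suml ler_wpM2r // sum_exceed // ltW.
  rewrite sumr_const -[leLHS]mulr_natl -[_ * delta * lt]mulrA mulrCA ler_pM2l //.
  by rewrite ler_wpM2r ?card_pairs_le // mulr_ge0 // ltW.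
set A : R := gamma * ln 2 + _; set B : R := 3 * m%:R ^+ 4 * l10.
have B0 : 0 <= B by rewrite !mulr_ge0 // exprn_ge0.
have h1 : \sum_(x in F) \sum_(e : pairs V) ln (w x e).+1%:R <=
    #|F|%:R * (n ^+ 2 * (A + B * ((2 * eps / tau + 6 * tau) / delta ^+ 6))).
  apply: (@le_trans _ _ (\sum_(x in F) (n ^+ 2 * A + B * (#|bad4 (w x)|%:R / n ^+ 2)))).
    apply: ler_sum => x _; apply: supersaturation => // e; exact: cap_le.
  rewrite big_split /= sumr_const -[_ *+ _]mulr_natl -mulr_sumr -mulr_suml.
  rewrite [n ^+ 2 * (A + _)]mulrDr [leRHS]mulrDr lerD2l.
  have -> : #|F|%:R * (n ^+ 2 * (B * ((2 * eps / tau + 6 * tau) / delta ^+ 6))) =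
      B * (#|F|%:R * n ^+ 2 * (2 * eps / tau + 6 * tau) / delta ^+ 6) by ring.
  rewrite ler_wpM2l // ler_pdivrMr ?exprn_gt0 // mulrAC ler_pdivlMr ?exprn_gt0 //.
  by move: bad; rewrite -/w; move: (\sum_(x in F) _) => b; lra.
rewrite -/w; move: h1 h2 h3; clear; move: (\sum_(x in F) _) => s1; move: (\sum_(x in F) _) => s2.
by move: (\sum_(x in F) _) => s3; rewrite !mulrDr; lra.
Qed.

End Upper.

(** Five error terms get [xi / 5] each. The order of choice is [m], [theta], [delta], then [tau] and
    [eps], and finally the threshold for [#|V|]. *)
Lemma upper_bound (R : realType) (xi : R) : 0 < xi -> exists n0, forall V : finType,
  (n0 <= #|V|)%N -> ln #|sparse49 V|%:R <= (gamma * ln 2 + xi) * #|V|%:R ^+ 2.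
Proof.
move=> xi0; have xi5 : 0 < xi / 5 by rewrite divr_gt0.
have l10 : 0 <= ln 10 :> R by exact: ln_nat_ge0.
pose K : R := gamma * ln 2 + extremal_cst R.
have [m m4 mK] : exists2 m, (4 <= m)%N & K / (m%:R - 1) <= xi / 5.
  exists (Num.truncn (`|K| / (xi / 5))).+4 => //.
  set t := `|K| / (xi / 5).
  have t0 : 0 <= t by rewrite divr_ge0 // ltW.
  have : t < (Num.truncn t).+1%:R by rewrite truncnS_gt.
  rewrite -[in X in X -> _]natr1 -[_.+4]addn4 natrD => tt.
  have m0 : 0 < (Num.truncn t)%:R + 4 - 1 :> R by have := ler0n R (Num.truncn t); lra.
  rewrite ler_pdivrMr // mulrC -ler_pdivrMr // (le_trans (ler_wpM2r _ (ler_norm K))) //.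
    by rewrite invr_ge0 ltW.
  by rewrite -/t; lra.
pose theta : R := 1 - expR (- (xi / 5)).
have t01 : 0 < theta < 1.
  rewrite /theta subr_gt0 expR_lt1 oppr_lt0 xi5 /=.
  by have := expR_gt0 (- (xi / 5)); lra.
have lth : ln (1 - theta) = - (xi / 5) by rewrite /theta opprB addrC subrK expRK.
have lt0 : 0 <= ln (10 / theta).
  by case/andP: t01 => t0 t1; apply: ln_ge0; rewrite ler_pdivlMr //; lra.
pose delta : R := (1 + ln (10 / theta) / (xi / 5))^-1.
have D1 : 1 <= 1 + ln (10 / theta) / (xi / 5) by rewrite lerDl divr_ge0 // ltW.
have d01 : 0 < delta <= 1 by rewrite /delta invr_gt0 invf_le1 ?D1 ?(lt_le_trans _ D1).
have dl : delta * ln (10 / theta) <= xi / 5.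
  rewrite /delta mulrC ler_pdivrMr ?(lt_le_trans _ D1) // mulrDr mulr1.
  by rewrite [xi / 5 * _]mulrC divfK ?gt_eqF // lerDr ltW.
pose B : R := 3 * m%:R ^+ 4 * ln 10 / delta ^+ 6.
have B0 : 0 <= B.
  by case/andP: d01 => d0 _; rewrite divr_ge0 ?exprn_ge0 ?(ltW d0) // !mulr_ge0 // exprn_ge0.
(* Both [2 * eps / tau] and [6 * tau] become [xi / (10 * (B + 1))]. *)
pose tau : R := xi / (60 * (B + 1)); pose eps : R := tau * xi / (20 * (B + 1)).
have tau0 : 0 < tau by rewrite divr_gt0 // mulr_gt0 // ltr_wpDl.
have eps0 : 0 < eps by rewrite divr_gt0 // mulr_gt0 // ltr_wpDl.
have Bt : B * (2 * eps / tau + 6 * tau) <= xi / 5.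
  have -> : B * (2 * eps / tau + 6 * tau) = B / (B + 1) * (xi / 5).
    have B1 : B + 1 != 0 by rewrite gt_eqF // ltr_wpDl.
    have -> : 2 * eps / tau = xi / (10 * (B + 1)).
      by rewrite /eps; field; rewrite B1 gt_eqF.
    by rewrite /tau; field.
  by rewrite ler_piMl ?(ltW xi5) // ler_pdivrMr ?mul1r ?lerDl // ltr_wpDl.
pose c : R := 10 / eps * ln 10.
have c0 : 0 <= c by rewrite mulr_ge0 // divr_ge0 // ltW.
exists (maxn (maxn m 6) (Num.truncn (c / (xi / 5))).+1) => V.
rewrite !geq_max => /andP[/andP[mV V6] cV].
have mV' : (4 <= m <= #|V|)%N by rewrite m4.
apply: le_trans (ln_card_sparse49_le eps0 d01 t01 tau0 mV' V6) _.
have cn : c <= xi / 5 * #|V|%:R.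
  rewrite mulrC -ler_pdivrMr //; apply/ltW/(lt_le_trans (truncnS_gt _)).
  by rewrite ler_nat.
rewrite -/c -/K lth.
have -> : 3 * m%:R ^+ 4 * ln 10 * ((2 * eps / tau + 6 * tau) / delta ^+ 6) =
   B * (2 * eps / tau + 6 * tau) by rewrite /B; ring.
have n0 : 0 <= #|V|%:R :> R by [].
have : #|V|%:R * c <= #|V|%:R * (xi / 5 * #|V|%:R) by rewrite ler_wpM2l.
have n2 : 0 <= #|V|%:R ^+ 2 :> R by rewrite sqr_ge0.
move: (ler_wpM2l n2 mK) (ler_wpM2l n2 Bt) (ler_wpM2l n2 dl); clear.
move: (K / _) (B * _) (delta * _) #|V|%:R c => k b d n c'; rewrite !expr2; lra.
Qed.

(** * The split construction *)

Section Lower.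
Variables (R : realType) (V : finType) (A : {set V}).
Local Notation X := {ffun pairs V -> 'I_10}.

Definition split_cap (e : pairs V) : nat :=
  match #|val e :&: A| with 0 => 0 | 1 => 2 | _ => 1 end%N.

Lemma split_cap_le2 e : (split_cap e <= 2)%N.
Proof. by rewrite /split_cap; case: #|_| => [|[|]]. Qed.

Lemma pair_apply_split (T : Type) (t0 : T) (h : nat -> T) a b : a != b ->
  pair_apply t0 (fun e => h (split_cap e)) a b =
  h (if a \in A then (if b \in A then 1 else 2) else (if b \in A then 2 else 0))%N.
Proof.
move=> ab; have [e eE ->] := pair_apply_neq t0 (fun e => h (split_cap e)) ab.
congr h; rewrite /split_cap eE -sum1_card big_mkcond /=.
rewrite (eq_bigr (fun x => (x \in A) * (x \in [set a; b]))%N); last first.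
  by move=> x _; rewrite in_setI andbC; case: (x \in A); case: (x \in _).
have -> : (\sum_x (x \in A) * (x \in [set a; b]) = (a \in A) + (b \in A))%N.
  rewrite (bigD1 a) //= (bigD1 b) 1?eq_sym //= !inE !eqxx orbT !muln1 big1 ?addn0 // => x.
  by rewrite !inE => /andP[/negPf -> /negPf ->]; rewrite muln0.
by case: (a \in A); case: (b \in A).
Qed.

(** The product counts the [x] lying below [split_cap] everywhere, and all of them are in
    [sparse49 V]. *)
Lemma card_sparse49_ge : \prod_(e : pairs V) (split_cap e).+1%:R <= #|sparse49 V|%:R :> R.
Proof.
pose q (e : pairs V) (c : 'I_10) : R := (c <= split_cap e)%N%:R.
have -> : \prod_(e : pairs V) (split_cap e).+1%:R = \prod_(e : pairs V) \sum_c q e c.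
  apply: eq_bigr => e _; rewrite -natr_sum; congr (_%:R).
  have := split_cap_le2 e; case: (split_cap e) => [|[|[|k]]] // _;
  by rewrite !big_ord_recl big_ord0.
rewrite bigA_distr_bigA /= -sum1_card natr_sum [leRHS]big_mkcond /=.
apply: ler_sum => x _; have [xF|nxF] := boolP (x \in _).
  by apply: prodr_ile1 => e _; rewrite ler0n lern1 leq_b1.
have [/forallP H|] := boolP [forall e, x e <= split_cap e]%N.
  case/negP: nxF; rewrite inE; apply/forallP => Y; apply/implyP => /eqP Y4.
  apply: (@leq_trans (\sum_(e : pairs V | val e \subset Y) split_cap e)).
    by apply: leq_sum => e _; apply: H.
  have := enum_uniq Y; have : [set y in enum Y] = Y by apply/setP => y; rewrite inE mem_enum.
  move: Y4; rewrite cardE; case: (enum Y) => [|a [|b [|c [|d []]]]] // _ <- U.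
  rewrite -set4E pair_sum4 //; move: U; rewrite /= !inE !negb_or.
  case/andP=> /and3P[ab ac ad] /andP[/andP[bc bd] /andP[cd _]].
  rewrite !(pair_apply_split 0%N id) //.
  (* With 0, 1, 2, 3 or 4 vertices in [A] the total is 0, 6, 9, 9 or 6. *)
  by case: (a \in A); case: (b \in A); case: (c \in A); case: (d \in A).
rewrite negb_forall => /existsP[e /negPf He].
by rewrite (bigD1 e) //= /q He mul0r.
Qed.

Lemma ln_card_sparse49_ge : 2 * ln #|sparse49 V|%:R >=
  #|A|%:R ^+ 2 * ln 2 - #|A|%:R * ln 2 + 2 * (#|A|%:R * (#|V|%:R - #|A|%:R)) * ln 3 :> R.
Proof.
have P0 : 0 < \prod_(e : pairs V) (split_cap e).+1%:R :> R by apply: prodr_gt0.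
have lnP : ln (\prod_(e : pairs V) (split_cap e).+1%:R) =
    \sum_(e : pairs V) ln (split_cap e).+1%:R :> R by apply: ln_prod => e; rewrite ltr0n.
apply: (@le_trans _ _ (2 * \sum_(e : pairs V) ln (split_cap e).+1%:R)); last first.
  rewrite ler_pM2l // -lnP ler_ln ?posrE ?card_sparse49_ge //.
  exact: lt_le_trans P0 card_sparse49_ge.
rewrite [leRHS]mulr_natl.
have -> : \sum_(e : pairs V) ln (split_cap e).+1%:R =
    \sum_(e : pairs V | val e \subset [set: V]) ln (split_cap e).+1%:R :> R.
  by apply: eq_bigl => e; rewrite subsetT.
rewrite pair_sum.
pose chi (a : V) : R := (a \in A)%:R.
have sumchi : \sum_a chi a = #|A|%:R.
  by rewrite -natr_sum -sum1_card [in RHS]big_mkcond.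
under [X in _ <= X]eq_bigl do rewrite inE.
under [X in _ <= X]eq_bigr do under eq_bigl do rewrite inE.
have -> : \sum_a \sum_b pair_apply 0 (fun e => ln (split_cap e).+1%:R) a b =
   \sum_a \sum_b ((chi a * ln 2) * chi b - (b == a)%:R * (chi a * ln 2)
     + ((chi a * ln 3) * (1 - chi b) + ((1 - chi a) * ln 3) * chi b)) :> R.
  apply: eq_bigr => a _; apply: eq_bigr => b _; rewrite /chi.
  have [<-|ba] := eqVneq b a; first by rewrite pair_apply_diag; case: (b \in A) => /=; lra.
  rewrite (pair_apply_split 0 (fun k => ln k.+1%:R)) 1?eq_sym //.
  by case: (a \in A); case: (b \in A) => /=; rewrite ?ln1; lra.
have sum1chi : \sum_a (1 - chi a) = #|V|%:R - #|A|%:R.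
  by rewrite sumrB sumchi sumr_const.
under eq_bigr do rewrite !big_split /= -!mulr_sumr sumchi sum1chi sumrN -mulr_suml.
have sumeq a : \sum_b (b == a)%:R = 1 :> R.
  by rewrite (bigD1 a) //= eqxx big1 ?addr0 // => b /negPf ->.
under eq_bigr do rewrite sumeq mul1r.
rewrite !big_split /= sumrN -!mulr_suml sumchi sum1chi; lra.
Qed.

End Lower.

Lemma lower_bound (R : realType) (xi : R) : 0 < xi -> exists n0, forall n,
  (n0 <= n)%N -> (gamma * ln 2 - xi) * n%:R ^+ 2 <= ln #|sparse49 'I_n|%:R.
Proof.
move=> xi0; have l2 := ln2_gt0 R; have l3 := ln2_lt_ln3 R.
have b0 := beta_ge0 R; have b1 := beta_le1 R; have bE := beta_stationary R.
exists (Num.truncn ((ln 2 + ln 3) / xi)).+1 => n nn0.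
have n1 : 1 <= n%:R :> R by rewrite ler1n (leq_trans _ nn0).
have nxi : ln 2 + ln 3 <= xi * n%:R.
  rewrite mulrC -ler_pdivrMr //; apply/ltW/(lt_le_trans (truncnS_gt _)).
  by rewrite ler_nat.
have bn0 : 0 <= beta * n%:R :> R by rewrite mulr_ge0.
have /andP[aL aU] := truncn_itv bn0; set a := Num.truncn _ in aL aU.
have an : (a <= n)%N.
  by rewrite -(ler_nat R); apply: le_trans aL _; rewrite ler_piMl.
pose A : {set 'I_n} := [set i : 'I_n | (i < a)%N].
have cA : #|A| = a.
  rewrite -sum1_card (eq_bigl (fun i : 'I_n => (i < a)%N)); last by move=> i; rewrite inE.
  by rewrite -(big_ord_widen _ (fun=> 1%N) an) sum1_card card_ord.
have := ln_card_sparse49_ge R A; rewrite cA card_ord.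
set L := ln #|_|%:R; set x : R := a%:R in aL aU *; set N : R := n%:R in n1 nxi bn0 aL aU *.
rewrite -natr1 -/x in aU => main.
have gE : 2 * (gamma * ln 2) = beta ^+ 2 * ln 2 + 2 * beta * (1 - beta) * ln 3 :> R.
  by rewrite /gamma /log2; field; rewrite gt_eqF.
have xN : x <= N by rewrite ler_nat.
have t2 : (beta * N - x) ^+ 2 <= 1 by rewrite expr_le1 //; lra.
(* Expansion around [x = beta * N]: there is no linear term because [beta] is stationary, so
   rounding [beta * N] costs only a constant. *)
have key : x ^+ 2 * ln 2 + 2 * (x * (N - x)) * ln 3 =
    2 * (gamma * ln 2) * N ^+ 2 - (2 * ln 3 - ln 2) * (beta * N - x) ^+ 2.
  apply/eqP; rewrite gE -subr_eq0.
  have -> : x ^+ 2 * ln 2 + 2 * (x * (N - x)) * ln 3 -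
      ((beta ^+ 2 * ln 2 + 2 * beta * (1 - beta) * ln 3) * N ^+ 2 -
       (2 * ln 3 - ln 2) * (beta * N - x) ^+ 2) =
      2 * N * (x - beta * N) * (ln 3 - beta * (2 * ln 3 - ln 2)) by ring.
  by rewrite bE subrr mulr0.
have t3 : (2 * ln 3 - ln 2) * (beta * N - x) ^+ 2 <= 2 * ln 3 - ln 2.
  by rewrite ler_piMr //; lra.
have xl : x * ln 2 <= N * ln 2 by rewrite ler_wpM2r // ltW.
have : (ln 2 + ln 3) * N <= xi * N * N by rewrite ler_wpM2r //; lra.
have : ln 3 <= ln 3 * N by rewrite ler_peMr //; lra.
have : 0 <= ln 2 * N by rewrite mulr_ge0 //; lra.
move: main key t3 xl; clear -l2 l3; rewrite !expr2 => main key t3 xl h1 h2 h3.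
lra.
Qed.

(* Transfer to [F n 4 9] and the asymptotic statement *)
From mathcomp Require Import all_classical all_reals all_analysis.

Import numFieldNormedType.Exports.

Local Open Scope classical_set_scope.
Local Open Scope ring_scope.

Lemma exists_4superset (V : finType) (e : pairs V) : (4 <= #|V|)%N ->
  exists2 Y : {set V}, #|Y| = 4%N & val e \subset Y.
Proof.
move=> V4; have e2 := eqP (valP e).
have : (0 < 'C(#|V| - #|val e|, 4 - #|val e|))%N by rewrite e2 bin_gt0; lia.
rewrite -card_supersets ?e2 // card_gt0 => /set0Pn[Y]; rewrite inE => /andP[eY /eqP Y4].
by exists Y.
Qed.

(** For [n >= 4] all multiplicities are at most 9, so [F n 4 9] is the injective image of
    [sparse49 'I_n]; it is finite and [cardF] is its true cardinality. *)
Lemma cardF_sparse49 (n : nat) : (4 <= n)%N -> cardF n 4 9 = #|sparse49 'I_n|.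
Proof.
move=> n4; pose f (x : {ffun pairs 'I_n -> 'I_10}) : multigraph 'I_n := [ffun e => val (x e)].
have f_inj : injective f.
  by move=> x y /ffunP E; apply/ffunP => e; apply: val_inj; have := E e; rewrite !ffunE.
pose G := [fset f x | x in sparse49 'I_n]%fset.
have FE : F n 4 9 = [set` G].
  apply/seteqP; split=> w /= Fw.
    have w9 e : (w e <= 9)%N.
      have [|Y Y4 eY] := @exists_4superset 'I_n e; rewrite ?card_ord //.
      apply: leq_trans (Fw Y Y4); rewrite /multiplicity (bigD1 e) //=; exact: leq_addr.
    have fw : f [ffun e => inord (w e)] = w.
      by apply/ffunP => e; rewrite !ffunE /= inordK // ltnS.
    apply/imfsetP; exists [ffun e => inord (w e)] => //=.
    rewrite inE; apply/forallP => Y; apply/implyP => /eqP Y4.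
    apply: leq_trans (Fw Y Y4); apply: leq_sum => e _.
    by rewrite ffunE inordK // ltnS.
  move/imfsetP: Fw => [x /= xF ->] Y Y4; move: xF; rewrite inE => /forallP/(_ Y).
  rewrite Y4 eqxx /=; apply: leq_trans; apply: leq_sum => e _.
  by rewrite ffunE.
by rewrite /cardF FE set_fsetK card_imfset //= cardE.
Qed.

Lemma ler_norm_divB (K : realFieldType) (L v g xi m : K) : 0 < v ->
  (g * v - xi * v) * m <= L <= (g * v + xi * v) * m -> `|L / v - g * m| <= xi * m.
Proof.
move=> v0 /andP[lb ub]; move: lb ub; have -> : L = v * (L / v) by rewrite mulrC divfK ?gt_eqF.
have -> : (g * v - xi * v) * m = v * ((g - xi) * m) by ring.
have -> : (g * v + xi * v) * m = v * ((g + xi) * m) by ring.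
rewrite !ler_pM2l // mulrAC divff ?gt_eqF // mul1r ler_norml => lb ub.
by apply/andP; split; lra.
Qed.

Theorem theorem2p5 (R : realType) :
  exists eps : nat -> R,
    eps =o_\oo (fun n : nat => n%:R ^+ 2 : R) /\
    \forall n \near \oo,
      (cardF n 4 9)%:R = 2 `^ (gamma * n%:R ^+ 2 + eps n) :> R.
Proof.
have l2 := ln2_gt0 R.
(* The exact error is the witness: the formula then only needs a nonzero cardinality, and the two
   bounds enter through the little-o claim. *)
exists (fun n => ln (cardF n 4 9)%:R / ln 2 - gamma * n%:R ^+ 2); split.
  apply/eqoP => xi xi0.
  have xl : 0 < xi * ln 2 by rewrite mulr_gt0.
  have [n1 ub] := upper_bound xl; have [n2 lb] := lower_bound xl.
  exists (maxn 4 (maxn n1 n2)) => // n /=; rewrite !geq_max => /and3P[n4 nn1 nn2].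
  have {}ub := ub 'I_n; rewrite card_ord in ub; have {}ub := ub nn1.
  have {}lb := lb n nn2.
  rewrite cardF_sparse49 // [X in _ <= _ * X]ger0_norm ?sqr_ge0 //.
  by apply: ler_norm_divB => //; rewrite lb ub.
exists 4%N => // n /= n4; rewrite addrC subrK cardF_sparse49 //.
rewrite /powR pnatr_eq0 /= divfK ?gt_eqF // lnK // posrE ltr0n card_gt0.
exact: sparse49_neq0.
Qed.
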